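(* Let $n\ge1$, let $\alpha=(k,1^{n-k})$ with $k\in[n]$ be a hook, and let $\sigma\in\mathfrak S_n$ be of cycle type $\alpha$. Then $\sigma\in\Sigma_\alpha$ if and only if $\sigma$ satisfies the hook properties.
   Context: $[a,b]=\{c\in\mathbb Z\mid a\le c\le b\}$ and $[a]=[1,a]$. $\mathfrak S_n$ is the symmetric group on $[n]$ (products are compositions of functions), with Coxeter generators $s_i=(i,i+1)$ and Coxeter length function $\ell$ (number of inversions). Relation $\approx$: write $w\overset{s_i}{\to}w'$ if $w'=s_iws_i$ and $\ell(w')\le\ell(w)$. Let $\to$ be the reflexive and transitive closure of the union of the relations $\overset{s_i}{\to}$, $1\le i\le n-1$. Write $w\approx w'$ if $w\to w'$ and $w'\to w$; this is an equivalence relation on $\mathfrak S_n$. Element in stair form: let $(x_1,\dots,x_n)$ be the list with $x_{2i-1}=i$ and $x_{2i}=n-i+1$. For a composition $\alpha=(\alpha_1,\dots,\alpha_l)$ of $n$, $\sigma_\alpha\in\mathfrak S_n$ is the product of the disjoint cycles $(x_{\alpha_1+\dots+\alpha_{i-1}+1},\dots,x_{\alpha_1+\dots+\alpha_{i-1}+\alpha_i})$, $i=1,\dots,l$. $\Sigma_\alpha$ denotes the $\approx$-equivalence class of $\sigma_\alpha$ (here used for the hook $\alpha=(k,1^{n-k})$). For a $k$-cycle: a $k$-cycle $\tau\in\mathfrak S_k$ is oscillating if there is a positive integer $m\in\{\frac{k-1}2,\frac k2,\frac{k+1}2\}$ with $\tau([m])=[k-m+1,k]$. A subset $M\subseteq[k]$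 is connected in $\tau$ if there is $m\in M$ with $M=\{m,\tau(m),\dots,\tau^{|M|-1}(m)\}$; the $k$-cycle $\tau\in\mathfrak S_k$ has connected intervals if $[j,k-j+1]$ is connected in $\tau$ for all integers $j$ with $1\le j\le\frac k2$. Cycle standardization: for a $k$-cycle $(c_1,\dots,c_k)$ in $\mathfrak S_n$, $\operatorname{cst}((c_1,\dots,c_k))\in\mathfrak S_k$ is the $k$-cycle $(r_1,\dots,r_k)$ with $r_i=|\{j\in[k]\mid c_j\le c_i\}|$. A permutation $\sigma\in\mathfrak S_n$, written as a product of disjoint cycles including the trivial ones, is oscillating (resp. has connected intervals) if the cycle standardization of each of its cycles is oscillating (resp. has connected intervals). Hook properties: let $\sigma\in\mathfrak S_n$ be of cycle type $(k,1^{n-k})$, and put $m=\frac{k-1}2$ if $k$ is odd and $m=\frac k2$ if $k$ is even. $\sigma$ satisfies the hook properties if (1) $\sigma$ is oscillating, (2) $\sigma$ has connected intervals, (3) if $k>1$ then $i$ and $n-i+1$ appear in the cycle of length $k$ of $\sigma$ for all $i\in[m]$. *)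

(* Defs.v *)
From HB Require Import structures.
From mathcomp Require Import all_boot all_fingroup.

Set Implicit Arguments.
Unset Strict Implicit.
Unset Printing Implicit Defensive.

(* [n] is rendered by 'I_n, with i : 'I_n standing for i + 1.
   Formulas about intervals go through [itv], which is 1-based. *)
Definition itv (n a b : nat) : {set 'I_n} := [set i : 'I_n | a <= i.+1 <= b].

(* The cycle (c_1, ..., c_k). [next c] is a permutation as soon as c has no
   repetition; undup only serves to make the definition total. *)
Definition cycle_perm (T : finType) (c : seq T) : {perm T} :=
  perm (can_inj (prev_next (undup_uniq c))).

Lemma cycle_permE (T : finType) (c : seq T) (x : T) :
  uniq c -> cycle_perm c x = next c x.
Proof. by move=> uc; rewrite permE undup_id. Qed.

(* Partitions are given as sequences of parts; fixed points of s count as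
   orbits of size 1. *)
Definition has_cycle_type (T : finType) (s : {perm T}) (la : seq nat) : bool :=
  perm_eq [seq #|C| | C : {set T} in porbits s] la.

Definition hook (n k : nat) : seq nat := k :: nseq (n - k) 1.

Section Arrow.
Variable n : nat.
Implicit Types w : 'S_n.

Definition coxeter_length w : nat :=
  #|[set p : 'I_n * 'I_n | (p.1 < p.2) && (w p.2 < w p.1)]|.

(* w' = s_i w s_i for the simple transposition s_i = (i, j), j = i + 1. *)
Definition cox_step w w' : bool :=
  [exists i : 'I_n, exists j : 'I_n,
    [&& j == i.+1 :> nat,
        w' == (tperm i j * w * tperm i j)%g
      & coxeter_length w' <= coxeter_length w]].

Definition cox_arrow : rel 'S_n := connect cox_step.

Definition cox_approx w w' : bool := cox_arrow w w' && cox_arrow w' w.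

End Arrow.

Section StairForm.
Variable n : nat.

Lemma half_ord_proof (i : 'I_n) : i./2 < n.
Proof.
apply: leq_ltn_trans (ltn_ord i).
by rewrite leq_half_double leqW // -addnn leq_addr.
Qed.

Definition half_ord (i : 'I_n) : 'I_n := Ordinal (half_ord_proof i).

(* x_1, x_2, x_3, x_4, ... = 1, n, 2, n-1, ...; the 0-based position j is even
   for x_{2i-1} and odd for x_{2i}, with i = j./2 + 1 in both cases. *)
Definition stair_seq : seq 'I_n :=
  [seq if odd j then rev_ord (half_ord j) else half_ord j | j : 'I_n <- enum 'I_n].

(* For alpha a composition of n, [reshape] cuts the list x into consecutive
   blocks of lengths alpha_1, ..., alpha_l. *)
Definition stair_perm (alpha : seq nat) : 'S_n :=
  (\prod_(c <- reshape alpha stair_seq) cycle_perm c)%g.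

Definition Sigma_class (alpha : seq nat) : {set 'S_n} :=
  [set w | cox_approx (stair_perm alpha) w].

End StairForm.

Section Standardization.
Variables n k : nat.
Implicit Type c : k.-tuple 'I_n.

Lemma cst_rank_proof c (i : 'I_k) :
  #|[set j : 'I_k | tnth c j <= tnth c i]|.-1 < k.
Proof.
case: k c i => [|k'] c i; first by case: i.
by rewrite ltnS -subn1 leq_subLR add1n -[leqRHS]card_ord max_card.
Qed.

(* The predecessor turns the 1-based value r_i into an element of 'I_k. *)
Definition cst_rank c (i : 'I_k) : 'I_k := Ordinal (cst_rank_proof c i).

Definition cst c : 'S_k := cycle_perm [seq cst_rank c i | i <- enum 'I_k].

End Standardization.

Section KCycle.
(* The predicates ending in _cycle are meant for tau a k-cycle. *)
Variables (k : nat) (tau : 'S_k).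

(* The disjunction is m = (k-1)/2, k/2 or (k+1)/2 as rational numbers. *)
Definition oscillating_cycle : Prop :=
  exists m : nat,
    [/\ 0 < m,
        [\/ m.*2.+1 = k, m.*2 = k | m.*2 = k.+1]
      & tau @: itv k 1 m = itv k (k - m + 1) k].

Definition connected_in (M : {set 'I_k}) : Prop :=
  exists2 m : 'I_k, m \in M & M = [set x in traject tau m #|M|].

Definition connected_intervals_cycle : Prop :=
  forall j : nat, 1 <= j -> j.*2 <= k -> connected_in (itv k j (k - j + 1)).

End KCycle.

Section Hook.
Variables (n : nat) (sigma : 'S_n).

(* [fingraph.orbit sigma x] lists the cycle of x as x, sigma x, sigma^2 x, ...; letting
   x range over 'I_n covers all cycles, the trivial ones included. The
   permutation [cst] does not depend on the starting point of the cycle. *)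
Definition oscillating : Prop :=
  forall x : 'I_n, oscillating_cycle (cst (in_tuple (fingraph.orbit sigma x))).

Definition connected_intervals : Prop :=
  forall x : 'I_n, connected_intervals_cycle (cst (in_tuple (fingraph.orbit sigma x))).

Definition hook_mid (k : nat) : nat := if odd k then k.-1./2 else k./2.

(* [rev_ord i] is n - i + 1 in 1-based terms. When sigma has cycle type
   (k, 1^(n-k)) and k > 1, the orbit C of size k is unique. *)
Definition hook_properties (k : nat) : Prop :=
  [/\ oscillating,
      connected_intervals
    & 1 < k ->
      exists C : {set 'I_n},
        [/\ C \in porbits sigma, #|C| = k
          & forall i : 'I_n, i \in itv n 1 (hook_mid k) ->
              i \in C /\ rev_ord i \in C]].

End Hook.

(* Main.v *)
Require Import Defs.
From HB Require Import structures.
From mathcomp Require Import all_boot all_fingroup.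
From mathcomp Require Import zify.

(* Let w0 be the reversal i |-> n + 1 - i. For a k-cycle tau in S_k put
   u := tau * w0; then len tau + len u is constant. If neither s_j nor s_(k-j)
   occurs in a reduced word of u, then u preserves [1, j] and [1, k - j], so
   tau preserves [1, j] \cup [k - j + 1, k]. Hence for every j < k / 2 one of
   the two must occur, and len u >= (k - 1) / 2, with equality iff each pair
   {s_j, s_(k-j)} contributes exactly one letter and s_(k/2) none. In terms of
   the numbers of x with x <= j < u x this is equivalent to tau being
   oscillating with connected intervals; the converse uses that u then avoids
   the pattern 321. A fixed point of sigma lengthens it by at most
   2 * floor (k / 2) inversions, with equality exactly under condition (3). So
   the hook properties characterize the elements of maximal length in the
   conjugacy class, and every conjugation between two such elements is a legal
   step. Finally, moving the first letter s_j of a word of u to the end as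
   s_(k-j) is the conjugation of tau by s_j, and these cyc_moves together with
   commutations bring every such word to the one of the stair form. *)

Set Implicit Arguments.
Unset Strict Implicit.
Unset Printing Implicit Defensive.

(** * Inversions and crossings *)

Section Crossing.
Variable n : nat.
Implicit Types (u s : 'S_n) (j : nat).

(** With 0-based points, [x < j] describes the first [j] points: this counts the points carried
    upwards over the cut that follows them. *)
Definition crossing j u : nat := #|[set x : 'I_n | x < j <= u x]|.

(** The first [j] points and their preimage have the same cardinality, hence so have the two
    differences of these sets. *)
Lemma crossing_down j u : #|[set x : 'I_n | u x < j <= x]| = crossing j u.
Proof.
pose P := [set x : 'I_n | x < j]; pose Q := [set x : 'I_n | u x < j].
have cPQ : #|Q| = #|P|.
  have -> : Q = u @^-1: P by apply/setP=> x; rewrite !inE.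
  by rewrite -[in RHS](card_preimset P (@perm_inj _ u)).
have -> : [set x : 'I_n | u x < j <= x] = Q :\: P.
  by apply/setP=> x; rewrite !inE -leqNgt andbC.
rewrite /crossing; have -> : [set x : 'I_n | x < j <= u x] = P :\: Q.
  by apply/setP=> x; rewrite !inE -leqNgt andbC.
by rewrite !cardsD setIC cPQ.
Qed.

Lemma card_ord_itv a b : b <= n -> #|[set y : 'I_n | a <= y < b]| = b - a.
Proof.
have E (P : pred nat) : #|[set y : 'I_n | P y]| = count P (iota 0 n).
  by rewrite cardsE cardE -val_enum_ord count_map -size_filter enumT. 
move=> bn; rewrite (E (fun i => a <= i < b)); have [ab|ba] := leqP a b; last first.
  have -> : b - a = 0 by lia.
  by rewrite -[RHS](count_pred0 (iota 0 n)); apply: eq_count => i /=; lia.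
have -> : n = a + ((b - a) + (n - b)) by lia.
rewrite !iotaD !count_cat add0n.
have -> : count (fun i => a <= i < b) (iota 0 a) = 0.
  rewrite -[RHS](count_pred0 (iota 0 a)); apply: eq_in_count => i.
  by rewrite mem_iota /=; lia.
have -> : count (fun i => a <= i < b) (iota (a + (b - a)) (n - b)) = 0.
  rewrite -[RHS](count_pred0 (iota (a + (b - a)) (n - b))); apply: eq_in_count => i.
  by rewrite mem_iota /=; lia.
rewrite -[RHS](size_iota a) -[RHS](count_predT) add0n addn0.
by apply: eq_in_count => i; rewrite mem_iota /=; lia.
Qed.

Lemma card_ord_lt b : b <= n -> #|[set y : 'I_n | y < b]| = b.
Proof. by move=> bn; rewrite -[RHS]subn0 -(@card_ord_itv 0). Qed.

Definition pairs_count : nat := #|[set p : 'I_n * 'I_n | p.1 < p.2]|.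

Definition w0 : 'S_n := perm (@rev_ord_inj n).

Lemma w0E (x : 'I_n) : w0 x = rev_ord x. Proof. by rewrite permE. Qed.

Lemma w0K : (w0 * w0 = 1)%g.
Proof. by apply/permP=> x; rewrite permM !w0E rev_ordK perm1. Qed.

(** Reversing the values exchanges inversions with non-inversions. *)
Lemma coxeter_length_w0 u :
  coxeter_length (u * w0) + coxeter_length u = pairs_count.
Proof.
rewrite addnC /pairs_count -(cardsID [set p : 'I_n * 'I_n | u p.2 < u p.1]).
congr (_ + _); apply: eq_card => -[x y]; rewrite !inE ?permM ?w0E //= andbC.
have [xy|yx] := ltnP x y; last by rewrite ?andbF.
have : u x != u y by rewrite (inj_eq perm_inj) neq_ltn xy.
rewrite -(inj_eq val_inj) /=; have := ltn_ord (u x); have := ltn_ord (u y); lia.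
Qed.

Lemma coxeter_length_sum u :
  coxeter_length u = \sum_(x < n) #|[set y : 'I_n | (x < y) && (u y < u x)]|.
Proof.
under eq_bigr => x _ do rewrite -sum1dep_card.
by rewrite (pair_big_dep xpredT (fun x y : 'I_n => (x < y) && (u y < u x))) /= sum1dep_card.
Qed.

(** Double counting of the pairs [(j, x)] with [x < j <= u x]. *)
Lemma sum_crossing u : \sum_(j < n) crossing j u = \sum_(x < n) (u x - x).
Proof.
rewrite /crossing; under eq_bigr => j _ do rewrite -sum1dep_card.
rewrite (exchange_big_dep xpredT) //=; apply: eq_bigr => x _.
rewrite sum1dep_card -[u x - x](@subSS) -card_ord_itv //.
Qed.

(* [u x - x] is the number of [y > x] with [u y < u x] minus the number of
   [y < x] with [u y > u x]; without 321 one of the two vanishes. *)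
Lemma coxeter_length_no321 u :
  (forall x y z : 'I_n, x < y < z -> ~~ (u z < u y < u x)) ->
  coxeter_length u <= \sum_(x < n) (u x - x).
Proof.
move=> H; rewrite coxeter_length_sum; apply: leq_sum => x _.
have [->|/set0Pn[z]] := eqVneq [set y : 'I_n | (x < y) && (u y < u x)] set0.
  by rewrite cards0.
rewrite inE => /andP[xz uz].
have below (y : 'I_n) : y < x -> u y < u x.
  move=> yx; have := H y x z; rewrite yx xz uz /= => /(_ isT); rewrite -leqNgt leq_eqVlt.
  by rewrite (inj_eq val_inj) (inj_eq perm_inj) -(inj_eq val_inj) (ltn_eqF yx).
have E : #|[set y : 'I_n | u y < u x]| = u x.
  rewrite -[RHS]card_ord_lt ?[u x <= n]ltnW //.
  rewrite -[in RHS](card_preimset _ (@perm_inj _ u)).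
  by apply: eq_card => y; rewrite !inE.
rewrite -[X in _ <= X - _]E -[X in _ <= _ - X]card_ord_lt ?[x <= n]ltnW //.
have /setIidPr <- : [set y : 'I_n | y < x] \subset [set y : 'I_n | u y < u x].
  by apply/subsetP=> y; rewrite !inE => /below.
rewrite -cardsD; apply/subset_leq_card/subsetP=> y; rewrite !inE.
by move=> /andP[xy ->]; rewrite -leqNgt ltnW.
Qed.

End Crossing.

Lemma card_exit_entry (T : finType) (s : {perm T}) (P : {set T}) :
  #|[set x in P | s x \notin P]| = #|[set x | (x \notin P) && (s x \in P)]|.
Proof.
have -> : [set x in P | s x \notin P] = P :\: s @^-1: P.
  by apply/setP=> x; rewrite !inE andbC.
have -> : [set x | (x \notin P) && (s x \in P)] = s @^-1: P :\: P.
  by apply/setP=> x; rewrite !inE.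
by rewrite !cardsD setIC card_preimset //; exact: perm_inj.
Qed.

(** A single orbit covering the whole type, expressed by stable sets because the arguments below
    exhibit such sets. *)
Definition full_cycle (T : finType) (s : {perm T}) : Prop :=
  forall A : {set T}, A != set0 -> (forall x, x \in A -> s x \in A) -> A = setT.

Lemma full_cycle_conj (T : finType) (s t : {perm T}) :
  full_cycle s -> full_cycle (s ^ t).
Proof.
move=> full A /set0Pn[a aA] stA.
have tA : t @^-1: A = setT.
  apply: full; first by apply/set0Pn; exists (t^-1 a)%g; rewrite inE permKV.
  by move=> x; rewrite !inE => /stA; rewrite permJ.
apply/setP=> x; rewrite inE; have := in_setT (t^-1 x)%g.
by rewrite -tA inE permKV.
Qed.

(** Folding at [k / 2] pairs [j] with [k - j]; there are [k.-1./2] pairs, and neither index 0 nor a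
    middle index contributes. *)
Lemma sum_folded (k : nat) (c : nat -> nat) :
    c 0 = 0 -> (forall i, 0 < i -> i.*2 < k -> c i + c (k - i) <= 1) ->
    (~~ odd k -> c k./2 = 0) ->
  \sum_(j < k) c j <= k.-1./2.
Proof.
move=> c0 c1 cmid; rewrite -(big_mkord xpredT).
have [->|k0] := posnP k; first by rewrite big_geq.
rewrite big_ltn // c0 add0n; set M := k.-1./2.
rewrite (@big_cat_nat _ _ _ M.+1) /=; try lia.
rewrite (@big_cat_nat _ _ _ (k - M) M.+1) /=; try lia.
have -> : \sum_(M.+1 <= j < k - M) c j = 0.
  rewrite big_nat_cond big1 // => j jM.
  by rewrite (_ : j = k./2) ?cmid; lia.
have -> : \sum_(k - M <= j < k) c j = \sum_(1 <= j < M.+1) c (k - j).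
  rewrite big_nat_rev /= -{1}[k - M]add0n big_addn.
  rewrite [RHS]big_add1 /=; have -> : k - (k - M) = M by lia.
  by apply: eq_big_nat => j jM; congr c; lia.
rewrite add0n -big_split /=; apply: (@leq_trans (\sum_(1 <= j < M.+1) 1)).
  rewrite big_nat_cond [leqRHS]big_nat_cond; apply: leq_sum => j jM; apply: c1; lia.
by rewrite sum_nat_const_nat; lia.
Qed.

(** * Crossing numbers of full cycles, oscillation and connected intervals *)

Section Full.
Variable k : nat.
Implicit Types (tau : 'S_k) (M : {set 'I_k}) (i j m : nat).

(** Only the last point of the trajectory filling [M] can leave [M]. *)
Lemma connected_in_exits tau M :
  connected_in tau M -> #|[set x in M | tau x \notin M]| <= 1.
Proof.
case=> m _ {1 2}->; rewrite -(cards1 (iter #|M|.-1 tau m)).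
apply/subset_leq_card/subsetP=> x; rewrite !inE => /andP[/trajectP[l lM ->]].
rewrite -iterS; have [lM1|Ml _] := ltnP l.+1 #|M|; last first.
  have -> : #|M|.-1 = l by lia. exact: eqxx.
by case/trajectP; exists l.+1.
Qed.

(** The trajectory is started right after an entry into [M]; with a single exit available it cannot
    leave before all of [M] is visited. *)
Lemma exits_connected_in tau M :
    full_cycle tau -> M != set0 -> #|[set x in M | tau x \notin M]| <= 1 ->
  connected_in tau M.
Proof.
move=> full M0 /card_le1_eqP exit1.
(* Without any entry the complement of [M] is stable, so [M] is everything and any start will do. *)
have [m mM start] : exists2 m, m \in M & forall x, x \in M -> tau x = m -> M = setT.
  have [/existsP[x /andP[xM txM]]|noentry] :=
      boolP [exists x, (x \notin M) && (tau x \in M)].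
    by exists (tau x) => // y yM /perm_inj yx; rewrite yx (negPf xM) in yM.
  case/set0Pn: (M0) => m mM; exists m => // _ _ _.
  apply: setC_inj; rewrite setCT; apply/eqP.
  apply: contraNT M0 => CM0; rewrite -[M]setCK (full (~: M)) ?setCT //.
  move=> x; rewrite !inE => xM; apply: contra noentry => txM.
  by apply/existsP; exists x; rewrite xM.
exists m => //.
have step i : 0 < i <= #|M| ->
    [set x in traject tau m i] \subset M /\ #|[set x in traject tau m i]| = i.
  elim: i => // -[_ _|i IH /andP[_ iM]].
    have -> : [set x in traject tau m 1] = [set m].
      by apply/setP=> x; rewrite [in LHS]inE /= mem_seq1 inE.
    by rewrite sub1set cards1.
  have [|AM cA] := IH; first by rewrite (ltnW iM).
  pose A := [set x in traject tau m i.+1]; rewrite -/A in AM cA.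
  have -> : [set x in traject tau m i.+2] = iter i.+1 tau m |: A.
    by apply/setP=> x; rewrite in_setU1 !in_set trajectSr mem_rcons in_cons.
  have memA x : reflect (exists2 l, l < i.+1 & x = iter l tau m) (x \in A).
    by rewrite in_set; exact: trajectP.
  have inA l : l < i.+1 -> iter l tau m \in A by move=> li; apply/memA; exists l.
  clearbody A.
  have yA : iter i.+1 tau m \notin A.
    apply/negP=> yA; have AT : A = setT.
      apply: full; first by apply/set0Pn; exists m; apply: (inA 0).
      move=> x /memA[l li ->]; rewrite -iterS.
      by move: li; rewrite leq_eqVlt => /predU1P[[->]//|/inA].
    by move: iM; rewrite -cA AT ltnNge cardsT max_card.
  have yM : iter i.+1 tau m \in M.
    (* Now [iter i tau m] is the only exit, so [M :\: A] is stable; being everything, it would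
       contain [m]. *)
    apply/negPn/negP=> yM.
    have MT : M :\: A = setT.
      apply: full; first by rewrite -card_gt0 cardsD (setIidPr AM) cA subn_gt0.
      move=> x; rewrite !in_setD => /andP[xA xM]; apply/andP; split.
        apply: contra xA => /memA[[|l] li /=]; last by move/perm_inj->; apply: inA; lia.
        by move=> /(start _ xM) MT; rewrite MT inE in yM.
      apply: contraNT xA => txM.
      rewrite (_ : x = iter i tau m) ?inA //.
      by apply: exit1; rewrite inE ?xM // (subsetP AM) ?inA.
    by have := in_setT m; rewrite -MT in_setD (inA 0).
  by rewrite subUset sub1set yM AM cardsU1 yA cA.
have [|AM cA] := step #|M|; first by rewrite card_gt0 M0 /=.
by apply/esym/eqP; rewrite eqEcard AM cA leqnn.
Qed.

(** The crossings of [tau * w0] at [i] are the points of the first [i] that [tau] does not send into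
    the last [i]; [crossing_up] is the mirror image. *)
Lemma crossing_lo tau i : i <= k ->
  crossing i (tau * w0 k) = #|[set x : 'I_k | (x < i) && (tau x < k - i)]|.
Proof.
move=> ik; apply: eq_card => x; rewrite !inE permM w0E /=.
have := ltn_ord (tau x); lia.
Qed.

Lemma crossing_up tau i : 0 < i <= k ->
  crossing (k - i) (tau * w0 k) = #|[set x : 'I_k | (k - i <= x) && (i <= tau x)]|.
Proof.
move=> ik; rewrite -crossing_down; apply: eq_card => x; rewrite !inE permM w0E /=.
have := ltn_ord (tau x); lia.
Qed.

(** If neither cut is crossed, [tau] exchanges the first [i] and the last [i] points, whose union is
    then stable but misses the point [i]. *)
Lemma full_cycle_crossing tau i : full_cycle tau -> 0 < i -> i.*2 < k ->
  0 < crossing i (tau * w0 k) + crossing (k - i) (tau * w0 k).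
Proof.
move=> full i0 ik; rewrite crossing_lo ?crossing_up; try lia.
rewrite lt0n addn_eq0; apply/negP=> /andP[/eqP/cards0_eq lo0 /eqP/cards0_eq up0].
have ltk : i < k by lia.
have := in_setT (Ordinal ltk).
rewrite -(full [set x : 'I_k | (x < i) || (k - i <= x)]); first by rewrite inE /=; lia.
  by apply/set0Pn; exists (Ordinal (leq_trans i0 (ltnW ltk))); rewrite inE i0.
move=> x; move/setP/(_ x): lo0; move/setP/(_ x): up0; rewrite !inE; lia.
Qed.

(* Together with [full_cycle_crossing]: the crossing numbers of [tau * w0] are
   as small as they can be for a [k]-cycle [tau]. *)
Definition tight (u : 'S_k) : Prop :=
  (forall i, 0 < i -> i.*2 < k -> crossing i u + crossing (k - i) u <= 1) /\
  (~~ odd k -> crossing k./2 u = 0).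

Lemma imset_itv tau m : 0 < m <= k ->
  tau @: itv k 1 m = itv k (k - m + 1) k <-> crossing m (tau * w0 k) = 0.
Proof.
move=> mk; rewrite crossing_lo; last by lia.
have lo : itv k 1 m = [set x : 'I_k | x < m] by apply/setP=> x; rewrite !inE; lia.
have up : itv k (k - m + 1) k = [set x : 'I_k | k - m <= x < k].
  by apply/setP=> x; rewrite !inE; lia.
split=> [E|/cards0_eq E0].
  apply/eqP; rewrite cards_eq0 -subset0; apply/subsetP=> x; rewrite inE => /andP[xm].
  have : tau x \in tau @: itv k 1 m by rewrite imset_f // lo inE.
  by rewrite E up !inE; lia.
apply/eqP; rewrite eqEcard; apply/andP; split.
  apply/subsetP=> _ /imsetP[x xm ->]; move: xm; rewrite lo up !inE.
  by move/setP/(_ x): E0; rewrite !inE; have := ltn_ord (tau x); lia.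
by rewrite card_imset ?lo ?up ?card_ord_itv ?card_ord_lt; [lia | lia | lia | exact: perm_inj].
Qed.

(** For odd [k > 1], tightness leaves one of the cuts [(k - 1) / 2] and [(k + 1) / 2] uncrossed, and
    that cut serves as [m]. *)
Lemma oscillating_tight tau :
    0 < k -> tight (tau * w0 k) -> oscillating_cycle tau.
Proof.
move=> k0 [t1 t0]; have [kodd|keven] := boolP (odd k); last first.
  exists k./2; split; [lia | by apply: Or32; lia | apply/imset_itv; [lia | exact: t0]].
have [k1|k1] := leqP k 1.
  exists 1; split; [lia | by apply: Or33; lia | apply/imset_itv; first by lia].
  apply/eqP; rewrite cards_eq0 -subset0; apply/subsetP=> x; rewrite inE.
  by have := ltn_ord ((tau * w0 k)%g x); lia.
have E : k - k./2 = k./2.+1 by lia.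
have := t1 k./2; rewrite E => /(_ ltac:(lia) ltac:(lia)) t.
have [c0|c1] := eqVneq (crossing k./2 (tau * w0 k)) 0.
  exists k./2; split; [lia | by apply: Or31; lia | by apply/imset_itv; [lia|]].
by exists k./2.+1; split; [lia | by apply: Or33; lia | apply/imset_itv; [lia|lia]].
Qed.

(** An entry into the interval comes from the first or the last [i] points and is counted by the
    crossing number at [i] or at [k - i]; so there is at most one entry, hence at most one exit. *)
Lemma connected_intervals_tight tau : full_cycle tau ->
  tight (tau * w0 k) -> connected_intervals_cycle tau.
Proof.
move=> full [t1 _] [//|i] _ ik.
have E : itv k i.+1 (k - i.+1 + 1) = [set x : 'I_k | i <= x < k - i].
  by apply/setP=> x; rewrite !inE; lia.
rewrite {}E; apply: exits_connected_in => //.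
  have ltk : i < k by lia.
  by apply/set0Pn; exists (Ordinal ltk); rewrite inE /=; lia.
rewrite card_exit_entry.
have [->|i0] := posnP i.
  rewrite (leq_trans _ (leq0n 1)) // leqn0 cards_eq0 -subset0.
  by apply/subsetP=> x; rewrite !inE; have := ltn_ord x; lia.
apply: leq_trans (t1 i i0 _); last by lia.
rewrite crossing_lo ?crossing_up; try lia.
apply: leq_trans (leq_card_setU _ _); apply/subset_leq_card/subsetP=> x.
by rewrite !inE; lia.
Qed.

Lemma oscillating_cycle_bounds tau : oscillating_cycle tau ->
  exists m, [/\ 0 < m <= k, k <= m.*2.+1 <= k.+2,
    forall x : 'I_k, x < m -> k - m <= tau x & forall x : 'I_k, m <= x -> tau x < k - m].
Proof.
case=> m [m0 km tau_m].
have {}km : m <= k /\ k <= m.*2.+1 <= k.+2 by case: km; lia.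
move/imset_itv: tau_m => c0; move/(_ ltac:(lia)): c0 => c0.
exists m; split; [lia | lia | |] => x xm; move: c0.
  rewrite crossing_lo; last by lia.
  by move/cards0_eq/setP/(_ x); rewrite !inE; lia.
rewrite -crossing_down; move/cards0_eq/setP/(_ x); rewrite !inE permM w0E /=.
by have := ltn_ord (tau x); lia.
Qed.

(** By oscillation no point of the first [i] stays among the first [i], and likewise for the last
    [i]. Hence every crossing at [i] or [k - i] is an entry into the middle interval, and
    connectedness allows only one. *)
Lemma tight_hook_cycle tau :
  oscillating_cycle tau -> connected_intervals_cycle tau -> tight (tau * w0 k).
Proof.
move=> osc conn; have [m [mk km lo hi]] := oscillating_cycle_bounds osc.
split=> [i i0 ik|keven]; last first.
  rewrite crossing_lo; last by lia.
  apply/eqP; rewrite cards_eq0 -subset0; apply/subsetP=> x; rewrite !inE => /andP[xk].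
  by have := lo x ltac:(lia); lia.
have M1 : #|[set x in itv k i.+1 (k - i.+1 + 1) |
              tau x \notin itv k i.+1 (k - i.+1 + 1)]| <= 1.
  (* Connectedness is given only for [i.+1.*2 <= k]; otherwise [k = i.*2.+1] and the interval is a
     single point. *)
  have [ik1|k1] := leqP i.+1.*2 k; first exact/connected_in_exits/conn.
  apply: (@leq_trans #|itv k i.+1 (k - i.+1 + 1)|).
    by apply/subset_leq_card/subsetP=> x; rewrite in_set => /andP[].
  have -> : itv k i.+1 (k - i.+1 + 1) = [set x : 'I_k | i <= x < i.+1].
    by apply/setP=> x; rewrite !inE; lia.
  by rewrite card_ord_itv; lia.
move: M1; rewrite card_exit_entry; apply: leq_trans.
rewrite crossing_lo ?crossing_up; try lia.
set C := [set x | _]; set A := [set x | _]; set B := [set x | _].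
have AB : A :&: B = set0 by apply/setP=> x; rewrite !inE; lia.
rewrite -cardsUI AB cards0 addn0.
apply/subset_leq_card/subsetP=> x; rewrite !inE.
by have [xm|xm] := ltnP x m; [have := lo x xm|have := hi x xm];
  move: (nat_of_ord (tau x)) => y; lia.
Qed.

(* The middle entry of a 321 pattern of [u] is forced to be a fixed point lying
   under a crossing; the opposite cuts are then not crossed, so that its
   reversal is fixed too and [tau] exchanges the two. *)
Lemma tight_no321 tau : full_cycle tau -> tight (tau * w0 k) ->
  forall x y z : 'I_k, x < y < z ->
  ~~ ((tau * w0 k)%g z < (tau * w0 k)%g y < (tau * w0 k)%g x).
Proof.
(* The positions of the pattern are now [z < x < y], with [x] in the middle. *)
move=> full [t1 t0] z x y /andP[zx xy]; apply/negP=> /andP[uyx uxz].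
set u := (tau * w0 k)%g in t1 t0 uyx uxz.
have c1 i : 0 < i < k -> crossing i u <= 1.
  move=> ik; have [i2|i2] := ltnP i.*2 k.
    by have := t1 i; lia.
  have [i2'|i2'] := eqVneq i.*2 k.
    by rewrite (_ : i = k./2) ?t0 //; lia.
  have := t1 (k - i); rewrite subKn; lia.
have two i (a b : 'I_k) : 0 < i < k -> a < i <= u a -> b < i <= u b -> a = b.
  move=> ik ai bi; have /card_le1_eqP := c1 i ik.
  by apply; rewrite inE.
have two' i (a b : 'I_k) : 0 < i < k -> u a < i <= a -> u b < i <= b -> a = b.
  move=> ik ai bi; have := c1 i ik; rewrite -crossing_down => /card_le1_eqP.
  by apply; rewrite inE.
have lz := ltn_ord z; have lx := ltn_ord x; have ly := ltn_ord y.
have lux := ltn_ord (u x); have luz := ltn_ord (u z).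
(* If [u x > x], both [z] and [x] go up over the cut [x.+1]; if [u x < x], both [x] and [y] come
   down over the cut [x]. *)
have ux : u x = x :> nat.
  apply/eqP; rewrite eqn_leq; apply/andP; split; rewrite leqNgt; apply/negP=> h.
    have xz := two x.+1 x z ltac:(lia) ltac:(lia) ltac:(lia).
    by move: zx; rewrite xz ltnn.
  have xy' := two' x x y ltac:(lia) ltac:(lia) ltac:(lia).
  by move: xy; rewrite xy' ltnn.
have pos i : z < i <= u z -> 0 < crossing i u.
  by move=> zi; rewrite card_gt0; apply/set0Pn; exists z; rewrite inE.
have cx := pos x ltac:(lia); have cx1 := pos x.+1 ltac:(lia).
have opp i : 0 < i < k -> 0 < crossing i u -> crossing (k - i) u = 0.
  move=> ik ci; have [i2|i2] := ltnP i.*2 k.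
    by have := t1 i; lia.
  have [i2'|i2'] := eqVneq i.*2 k.
    by move: ci; rewrite (_ : i = k./2) ?t0 //; lia.
  have := t1 (k - i); rewrite subKn; lia.
have cx' := opp x ltac:(lia) cx; have cx1' := opp x.+1 ltac:(lia) cx1.
have fix_rev : u (rev_ord x) = rev_ord x.
  apply: val_inj; apply/eqP; rewrite eqn_leq; apply/andP; split.
    move/cards0_eq/setP/(_ (rev_ord x)): cx'; rewrite !inE /=; lia.
  move: cx1'; rewrite -crossing_down => /cards0_eq/setP/(_ (rev_ord x)).
  by rewrite !inE /=; lia.
have tauE v : tau v = rev_ord (u v) by rewrite permM w0E rev_ordK.
have AT : [set x; rev_ord x] = setT.
  apply: full; first by apply/set0Pn; exists x; rewrite set21.
  move=> v /set2P[->|->]; rewrite tauE.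
    by rewrite (val_inj ux : u x = x) set22.
  by rewrite fix_rev rev_ordK set21.
have := in_setT z; have := in_setT y; rewrite -AT => /set2P[yE|yE] /set2P[zE|zE].
- by move: xy; rewrite yE ltnn.
- by move: xy; rewrite yE ltnn.
- by move: zx; rewrite zE ltnn.
- by move: (ltn_trans zx xy); rewrite zE yE ltnn.
Qed.

Lemma tight_length tau : full_cycle tau -> tight (tau * w0 k) ->
  coxeter_length (tau * w0 k) <= k.-1./2.
Proof.
move=> full t; apply: leq_trans (coxeter_length_no321 (tight_no321 full t)) _.
rewrite -sum_crossing; case: t => t1 t0.
apply: (@sum_folded k (fun j => crossing j (tau * w0 k)%g)) => //.
by apply/eqP; rewrite cards_eq0 -subset0; apply/subsetP=> x; rewrite inE.
Qed.

End Full.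

(** * Words in the simple transpositions *)

(** Exchanging two adjacent positions permutes the inversions other than the pair [(a, b)] itself;
    the additive form treats ascents and descents at once. *)
Lemma coxeter_length_tperm n (a b : 'I_n) (u : 'S_n) : b = a.+1 :> nat ->
  coxeter_length (tperm a b * u) + (u b < u a) = coxeter_length u + (u a < u b).
Proof.
move=> ba; rewrite /coxeter_length (cardsD1 (a, b)) [X in _ = X + _](cardsD1 (a, b)).
rewrite !inE !permM tpermL tpermR /= ba leqnn /=.
set A := _ :\ _; set B := _ :\ _; suff -> : #|A| = #|B|.
  by rewrite addnAC [RHS]addnAC; congr (_ + _); exact: addnC.
pose f (p : 'I_n * 'I_n) := (tperm a b p.1, tperm a b p.2).
have finj : injective f by move=> [x y] [z t] [/perm_inj-> /perm_inj->].
rewrite -[#|B|](card_preimset _ finj); apply: eq_card => -[x y].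
rewrite !inE !permM /= !xpair_eqE -!(inj_eq val_inj) /=.
move: (u (tperm a b y) < u (tperm a b x)) => c; rewrite !andbA; congr (_ && c).
have [->|->|/eqP xa /eqP xb] := tpermP a b x; have [->|->|/eqP ya /eqP yb] := tpermP a b y.
all: try (move: xa xb; rewrite -!(inj_eq val_inj) /=).
all: try (move: ya yb; rewrite -!(inj_eq val_inj) /=).
all: rewrite ?ba; lia.
Qed.

Lemma coxeter_length_tperm_le n (a b : 'I_n) (u : 'S_n) : b = a.+1 :> nat ->
  coxeter_length (tperm a b * u) <= (coxeter_length u).+1.
Proof.
move/(coxeter_length_tperm u) => E; rewrite -addn1.
apply: leq_trans (leq_addr (u b < u a) _) _; rewrite E leq_add2l; exact: leq_b1.
Qed.

Lemma coxeter_length_tperm_lt n (a b : 'I_n) (u : 'S_n) : b = a.+1 :> nat ->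
  u b < u a -> coxeter_length u = (coxeter_length (tperm a b * u)).+1.
Proof.
move=> /(coxeter_length_tperm u) E ba; move: E; rewrite ba addn1 => ->.
by rewrite ltnNge (ltnW ba) addn0.
Qed.

Lemma increasing_perm1 n (u : 'S_n) :
  (forall x y : 'I_n, x < y -> u x < u y) -> u = 1%g.
Proof.
move=> H; apply/permP=> x; rewrite perm1; apply: val_inj => /=.
rewrite -[LHS](@card_ord_lt n) ?[u x <= n]ltnW // -[RHS](@card_ord_lt n) ?[x <= n]ltnW //.
rewrite -(card_preimset _ (@perm_inj _ u)); apply: eq_card => y; rewrite !inE.
have [/H//|xy] := ltnP y x.
move: xy; rewrite leq_eqVlt => /predU1P[/val_inj->|/H]; first by rewrite ltnn.
by move=> h; apply/negbTE; rewrite -leqNgt ltnW.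
Qed.

Lemma coxeter_length1 n : coxeter_length (1%g : 'S_n) = 0.
Proof.
apply/eqP; rewrite cards_eq0 -subset0; apply/subsetP=> p.
by rewrite !inE !perm1; lia.
Qed.

Section Words.
Variable K : nat.
Local Notation k := K.+1.
Implicit Types (u tau : 'S_k) (w : seq nat) (i j : nat).

(* [adj j] is the simple transposition s_j = (j, j + 1); in the 0-based 'I_k it
   exchanges [j.-1] and [j]. *)
Definition adj j : 'S_k := tperm (inord j.-1) (inord j).

Definition word w : 'S_k := (\prod_(j <- w) adj j)%g.

Definition is_word w := all (fun j => 0 < j <= K) w.

Lemma word_cons j w : word (j :: w) = (adj j * word w)%g.
Proof. by rewrite /word big_cons. Qed.

Lemma word_cat w1 w2 : word (w1 ++ w2) = (word w1 * word w2)%g.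
Proof. by rewrite /word big_cat. Qed.

Lemma val_adj j (x : 'I_k) : 0 < j <= K ->
  adj j x = (if x == j.-1 :> nat then j else if x == j :> nat then j.-1 else x) :> nat.
Proof.
move=> jK; have j1 : (inord j.-1 : 'I_k) = j.-1 :> nat by rewrite inordK; lia.
have j2 : (inord j : 'I_k) = j :> nat by rewrite inordK; lia.
rewrite /adj; have [->|->|/eqP xa /eqP xb] := tpermP; rewrite ?j1 ?j2 ?eqxx //.
  by case: eqP => //; lia.
by move: xa xb; rewrite -!(inj_eq val_inj) /= j1 j2 => /negPf-> /negPf->.
Qed.

Lemma coxeter_length_word w : is_word w -> coxeter_length (word w) <= size w.
Proof.
elim: w => [|j w IH /= /andP[jK /IH]]; first by rewrite /word big_nil coxeter_length1.
rewrite word_cons -ltnS => len.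
apply: leq_trans len; apply: coxeter_length_tperm_le.
by rewrite !inordK; lia.
Qed.

(** A letter is stripped at a descent, which lowers the length by one; a permutation without
    descents is increasing, hence the identity. *)
Lemma reduced_word u :
  exists w, [/\ is_word w, word w = u & size w = coxeter_length u].
Proof.
have [m] := ubnP (coxeter_length u); elim: m u => // m IH u.
have [/existsP[j /andP[j0 desc]] len|asc _] :=
    boolP [exists j : 'I_k, (0 < j) && (u (inord j) < u (inord j.-1))].
  have jK := ltn_ord j.
  have E : coxeter_length u = (coxeter_length (adj j * u)).+1.
    by apply: coxeter_length_tperm_lt desc; rewrite !inordK; lia.
  have [|w [w1 w2 w3]] := IH (adj j * u)%g; first by rewrite -ltnS -E.
  exists (nat_of_ord j :: w); split; first by rewrite /= w1 andbT; lia.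
    by rewrite word_cons w2 mulgA /adj tperm2 mul1g.
  by rewrite /= w3 -E.
suff -> : u = 1%g by exists [::]; rewrite /word big_nil coxeter_length1.
apply: increasing_perm1 => x y xy.
have step (z : 'I_k) : 0 < z -> u (inord z.-1) < u z.
  move=> z0; have := asc; rewrite negb_exists => /forallP/(_ z).
  rewrite z0 /= -leqNgt leq_eqVlt inord_val => /predU1P[/val_inj/perm_inj/(congr1 val)/=|//].
  have zk := ltn_ord z; rewrite inordK; last by lia.
  by move=> zz; exfalso; lia.
have [d E] : exists d, y = x + d.+1 :> nat by exists (y - x.+1); lia.
elim: d y E {xy} => [|d IHd] y E.
  have := step y; rewrite E addn1 /= inord_val; apply; lia.
apply: leq_trans (step y _); last by lia.
by have := ltn_ord y => yk; rewrite ltnS ltnW // IHd // inordK; lia.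
Qed.

(** A letter [a] carries a single point upwards, and only over the cut [a], so each crossing of [j]
    costs an occurrence of [j]. *)
Lemma crossing_word j w : 0 < j -> is_word w -> crossing j (word w) <= count_mem j w.
Proof.
move=> j0; elim: w => [_|a w IH /= /andP[aK /IH {}IH]].
  rewrite /word big_nil leqn0 cards_eq0 -subset0; apply/subsetP=> x.
  by rewrite !inE perm1; lia.
rewrite word_cons addnC; apply: leq_trans (leq_add IH (leqnn _)).
have -> : (a == j : nat) = #|if a == j then [set (inord j : 'I_k)] else set0|.
  by case: eqP; rewrite ?cards1 ?cards0.
apply: leq_trans (leq_card_setU _ _).
rewrite -(card_preimset _ (@perm_inj _ (adj a))); apply/subset_leq_card/subsetP=> x.
rewrite !inE permM => /andP[xj ->]; rewrite andbT.
have [//|jx] := ltnP; have := val_adj x aK.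
have aj : a = j.
  by move: jx; rewrite val_adj //; case: eqP; [lia|case: eqP; lia].
subst a; rewrite eqxx inE => E; apply/eqP/val_inj; rewrite /= inordK; last by lia.
by move: jx; rewrite E; case: eqP; [lia|case: eqP; lia].
Qed.

(* s_j and s_(k - j), exchanged by conjugation with [w0], get the same index. *)
Definition orbit_index j := minn j (k - j).

(** An index missing from the word would leave both of its cuts uncrossed, against
    [full_cycle_crossing]. *)
Lemma letters_orbits tau w : full_cycle tau -> is_word w -> word w = (tau * w0 k)%g ->
  {subset iota 1 K./2 <= map orbit_index w}.
Proof.
move=> full lw E j; rewrite mem_iota => jM.
have := full_cycle_crossing full (_ : 0 < j) (_ : j.*2 < k).
move=> /(_ ltac:(lia) ltac:(lia)); rewrite -E.
have := @crossing_word j w ltac:(lia) lw; have := @crossing_word (k - j) w ltac:(lia) lw.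
move=> c1 c2 c0; have : 0 < count_mem j w + count_mem (k - j) w by lia.
rewrite addn_gt0 -!has_count !has_pred1 => /orP[] jw; apply/mapP.
  by exists j => //; rewrite /orbit_index; lia.
by exists (k - j) => //; rewrite /orbit_index; lia.
Qed.

Lemma length_lower tau : full_cycle tau -> K./2 <= coxeter_length (tau * w0 k).
Proof.
move=> full; have [w [lw E <-]] := reduced_word (tau * w0 k).
rewrite -(size_iota 1 K./2) -(size_map orbit_index w).
by apply: uniq_leq_size (letters_orbits full lw E); rewrite iota_uniq.
Qed.

Lemma full_word tau w : full_cycle tau -> is_word w -> word w = (tau * w0 k)%g ->
  size w = K./2 -> perm_eq (map orbit_index w) (iota 1 K./2).
Proof.
move=> full lw E sw; have sub := letters_orbits full lw E.
have [|_ eqi] := uniq_min_size (iota_uniq 1 K./2) sub.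
  by rewrite size_map size_iota sw.
rewrite perm_sym; apply: uniq_perm; rewrite ?iota_uniq //.
by rewrite (uniq_size_uniq (iota_uniq 1 K./2) eqi) size_map sw size_iota.
Qed.

(** In a reduced word each pair of opposite letters accounts for exactly one letter, which bounds
    its two crossing numbers together. *)
Lemma length_tight tau : full_cycle tau -> coxeter_length (tau * w0 k) = K./2 ->
  tight (tau * w0 k)%g.
Proof.
move=> full len; have [w [lw E sw]] := reduced_word (tau * w0 k).
have pw := full_word full lw E (etrans sw len).
have cnt j : count_mem j (map orbit_index w) = (1 <= j <= K./2).
  by rewrite (seq.permP pw) count_uniq_mem ?iota_uniq // mem_iota; congr (nat_of_bool _); lia.
have cle i : count_mem i w <= count_mem (orbit_index i) (map orbit_index w).
  by rewrite count_map; apply: sub_count => j /= /eqP->.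
rewrite -E; split=> [i i0 ik|keven].
  apply: leq_trans (leq_add (crossing_word i0 lw) (crossing_word _ lw)) _; first by lia.
  apply: leq_trans (_ : count_mem i (map orbit_index w) <= 1); last by rewrite cnt leq_b1.
  rewrite count_map -count_predUI -[leqRHS]addn0; apply: leq_add.
    by apply: sub_count => j /=; rewrite /orbit_index; lia.
  by rewrite leqn0 -(count_pred0 w); apply/eqP/eq_count => j /=; lia.
(* For even [k] the index [k / 2] exceeds [K./2], so the middle letter does not occur. *)
apply/eqP; rewrite -leqn0; apply: leq_trans (crossing_word _ lw) _; first by lia.
by apply: leq_trans (cle _) _; rewrite cnt /orbit_index; lia.
Qed.

End Words.

(** * Cyclic moves on words and their normal form *)

Lemma cat_eq_cat (T : Type) (s1 s2 t1 t2 : seq T) :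
    s1 ++ s2 = t1 ++ t2 -> size s1 <= size t1 ->
  exists r, t1 = s1 ++ r /\ s2 = r ++ t2.
Proof.
elim: s1 t1 => [|x s1 IH] [|y t1] //=; first by exists [::].
  by move=> -> _; exists (y :: t1).
by case=> -> /IH E /E[r [-> ->]]; exists r.
Qed.

Lemma iota_rcons m n : iota m n.+1 = rcons (iota m n) (m + n).
Proof. by rewrite -addn1 iotaD cats1. Qed.

Section Moves.
Variable K : nat.
Local Notation k := K.+1.
Local Notation M := K./2.
Local Notation orb := (orbit_index K).
Local Notation letters := (is_word K).
Implicit Types (w v : seq nat) (a b o : nat).

Definition far a b := (a.+1 < b) || (b.+1 < a).

Inductive cyc_move : seq nat -> seq nat -> Prop :=
| Swap w1 a b w2 of far a b : cyc_move (w1 ++ a :: b :: w2) (w1 ++ b :: a :: w2)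
| Shift a w : cyc_move (a :: w) (rcons w (k - a)).

Inductive cyc_moves : seq nat -> seq nat -> Prop :=
| MovesRefl w : cyc_moves w w
| MovesStep w1 w2 w3 of cyc_move w1 w2 & cyc_moves w2 w3 : cyc_moves w1 w3.

Lemma moves_trans w1 w2 w3 : cyc_moves w1 w2 -> cyc_moves w2 w3 -> cyc_moves w1 w3.
Proof. by elim=> // a b c ab _ IH /IH; exact: MovesStep. Qed.

Lemma move1 w v : cyc_move w v -> cyc_moves w v.
Proof. by move=> wv; apply: MovesStep wv (MovesRefl _). Qed.

Lemma moves_front w1 b w2 : all (far^~ b) w1 -> cyc_moves (w1 ++ b :: w2) (b :: w1 ++ w2).
Proof.
elim/last_ind: w1 w2 => [|w1 a IH] w2; first by move=> _; exact: MovesRefl.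
rewrite all_rcons => /andP[ab /IH w1b]; rewrite !cat_rcons.
by apply: MovesStep (w1b _); apply: Swap.
Qed.

Lemma move_letters w v : cyc_move w v -> letters w -> letters v.
Proof.
case=> [w1 a b w2 _|a w']; rewrite /is_word ?all_cat /= ?all_rcons; first by lia.
by case/andP=> aK ->; lia.
Qed.

Lemma move_orbs w v : cyc_move w v -> letters w -> perm_eq (map orb v) (map orb w).
Proof.
case=> [w1 a b w2 _ _|a w' /= /andP[aK _]].
  by rewrite !map_cat perm_cat2l /= (perm_catCA [:: _] [:: _]).
rewrite map_rcons perm_rcons (_ : orb (k - a) = orb a) //; rewrite /orbit_index; lia.
Qed.

Section Leaf.
Variable o : nat.
(** Among the letters of index above [o], a leaf has at most one neighbour: [o + 1] for the leaf
    [o], and [k - o - 1] for the leaf [k - o]. *)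
Let above w := all (fun a => o < orb a) w.
Let leaf b := (0 < b <= K) && (orb b == o).

(* Two far letters above [o] cannot both be adjacent to a letter of index [o],
   so the latter never prevents the move. *)
Lemma move_leaf w v w1 w2 b : cyc_move w v -> letters w -> above w -> leaf b ->
    w = w1 ++ w2 ->
  exists v1 v2 b', [/\ v = v1 ++ v2, leaf b' & cyc_moves (w1 ++ b :: w2) (v1 ++ b' :: v2)].
Proof.
case=> [p a c q ac|a w'] lw abw lb E.
  (* The leaf stands before the swapped pair, after it, or between its two letters; only in the last
     case must it commute with one of them. *)
  have [le|lt] := leqP (size w1) (size p).
    have [r [-> ->]] := cat_eq_cat (esym E) le.
    exists w1, (r ++ c :: a :: q), b; split=> //; first by rewrite catA.
    apply: move1; have := Swap (w1 ++ b :: r) q ac.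
    by rewrite -!catA.
  have [le|ge] := leqP (size p).+2 (size w1).
    have [||r [-> ->]] := @cat_eq_cat _ (p ++ [:: a; c]) q w1 w2.
    - by rewrite -E -catA.
    - by rewrite size_cat addn2.
    exists (p ++ [:: c, a & r]), w2, b; split=> //; first by rewrite -catA.
    apply: move1; have := Swap p (r ++ b :: w2) ac.
    by rewrite -!catA.
  have [||r [w1E qE]] := @cat_eq_cat _ (p ++ [:: a]) (c :: q) w1 w2.
  - by rewrite -E -catA.
  - by rewrite size_cat addn1.
  have r0 : r = [::].
    by apply/nilP; rewrite /nilp; move: ge; rewrite w1E !size_cat /=; lia.
  rewrite r0 cats0 /= in w1E qE; rewrite w1E -qE {w1E qE r0 r E}.
  move: lw abw; rewrite /is_word /above !all_cat /= /orbit_index.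
  move=> /and4P[_ aK cK _] /and4P[_ ao co _].
  have [ba|ba] := boolP (far a b).
    exists p, [:: c, a & q], b; split=> //; rewrite -catA /=.
    apply: MovesStep (Swap p (c :: q) ba) _.
    by have := Swap (p ++ [:: b]) q ac; rewrite -!catA => /move1.
  have bc : far b c by move: lb ba ac; rewrite /leaf /far /orbit_index; lia.
  exists (p ++ [:: c; a]), q, b; split=> //; rewrite -!catA //=.
  apply: (@MovesStep _ (p ++ [:: a, c, b & q])).
    by have := Swap (p ++ [:: a]) q bc; rewrite -!catA.
  by apply: move1; apply: Swap.
case: w1 E => [/= <-|x w1 /= [-> ->]].
  (* The leaf precedes the letter to be shifted, so it is shifted first and becomes [k - b], of the
     same index. *)
  exists w', [:: k - a], (k - b); rewrite cats1; split=> //.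
    by move: lb; rewrite /leaf /orbit_index; lia.
  apply: MovesStep (Shift b (a :: w')) _ => /=.
  by apply: move1; have := Shift a (rcons w' (k - b)); rewrite -!cats1 -!catA.
exists w1, (rcons w2 (k - x)), b; split=> //; first by rewrite rcons_cat.
by apply: move1; have := Shift x (w1 ++ b :: w2); rewrite rcons_cat.
Qed.

Lemma moves_leaf w v w1 w2 b : cyc_moves w v -> letters w -> above w -> leaf b ->
    w = w1 ++ w2 ->
  exists v1 v2 b', [/\ v = v1 ++ v2, leaf b' & cyc_moves (w1 ++ b :: w2) (v1 ++ b' :: v2)].
Proof.
move=> wv; elim: wv w1 w2 b => [w' w1 w2 b _ _ lb ->|x y z xy _ IH w1 w2 b lx ax lb E].
  by exists w1, w2, b; split=> //; exact: MovesRefl.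
have [v1 [v2 [b' [yE lb' bb']]]] := move_leaf xy lx ax lb E.
have ay : above y.
  move: ax; rewrite /above -!(all_map orb (fun i => o < i)).
  by rewrite (perm_all _ (move_orbs xy lx)).
have [z1 [z2 [b'' [zE lb'' b'b'']]]] := IH v1 v2 b' (move_letters xy lx) ay lb' yE.
by exists z1, z2, b''; split=> //; apply: moves_trans b'b''.
Qed.

End Leaf.

(** The letter [b] is [M - r] or [k - M + r]. The former commutes with all others, goes to the front
    and is shifted to the end as [k - M + r]. The latter fails to commute only with the last letter;
    unless already at the end, it goes to the front and is shifted, becoming the former. *)
Lemma moves_leaf_last r v1 v2 b : r < M -> 0 < b <= K -> orb b = M - r ->
    v1 ++ v2 = iota (k - M) r ->
  cyc_moves (v1 ++ b :: v2) (iota (k - M) r.+1).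
Proof.
move=> rM bK bo E; rewrite iota_rcons -E.
have mem x : x \in v1 ++ v2 -> k - M <= x < k - M + r by rewrite E mem_iota.
have low c u1 u2 : c = M - r -> u1 ++ u2 = v1 ++ v2 ->
    cyc_moves (u1 ++ c :: u2) (rcons (v1 ++ v2) (k - M + r)).
  move=> cE uE; apply: (@moves_trans _ (c :: u1 ++ u2)).
    apply: moves_front; apply/allP=> x xu.
    by have := mem x; rewrite -uE mem_cat xu /far => /(_ isT); lia.
  by rewrite uE (_ : k - M + r = k - c); [apply/move1/Shift | lia].
have [bMr|bM] := eqVneq b (M - r); first exact: low.
have bE : b = k - M + r by move: bo; rewrite /orbit_index; lia.
case/lastP: v2 E mem low => [|v2 y] E mem low.
  by rewrite cats0 bE cats1; exact: MovesRefl.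
apply: (@moves_trans _ (b :: v1 ++ rcons v2 y)).
  apply: moves_front; apply/allP=> x xv.
  have [r0|r0] := posnP r; first by move: (mem x); rewrite mem_cat xv r0; lia.
  have : uniq (v1 ++ rcons v2 y) by rewrite E iota_uniq.
  have yE : y = k - M + r.-1.
    have := congr1 (last 0) E; rewrite last_cat last_rcons => ->.
    by rewrite -(prednK r0) iota_rcons last_rcons.
  rewrite cat_uniq => /and3P[_ /hasPn/(_ y)].
  rewrite mem_rcons mem_head => /(_ isT) yv _.
  have xy : x != y by apply: contraNneq yv => <-.
  by move: (mem x); rewrite mem_cat xv /far => /(_ isT); lia.
apply: (@MovesStep _ (rcons (v1 ++ rcons v2 y) (k - b))); first exact: Shift.
by rewrite -cats1; apply: low; rewrite ?cats0 //; lia.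
Qed.

(** Induction from the index [M] downwards: the letter of smallest index is taken out, the rest is
    put in normal form while [moves_leaf] carries that letter along, and [moves_leaf_last] places
    it. *)
Lemma moves_canonical r w : r <= M -> letters w ->
  perm_eq (map orb w) (iota (M - r).+1 r) -> cyc_moves w (iota (k - M) r).
Proof.
elim: r w => [|r IH] w rM lw pw.
  have := perm_size pw; rewrite size_map => /size0nil->; exact: MovesRefl.
have ME : (M - r.+1).+1 = M - r by lia.
have : M - r \in map orb w by rewrite (perm_mem pw) ME /= mem_head.
case/mapP=> b bw bo; case/splitPr: bw lw pw => w1 w2 lw pw.
move: lw; rewrite /is_word all_cat /= => /and3P[l1 bK l2].
move: pw; rewrite ME /= map_cat /= -bo (perm_catCA _ [:: _]) perm_cons -map_cat => pw.
have l12 : letters (w1 ++ w2) by rewrite /is_word all_cat l1.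
have a12 : all (fun a => M - r < orb a) (w1 ++ w2).
  rewrite -(all_map orb (fun i => M - r < i)) (perm_all _ pw).
  by apply/allP=> x; rewrite mem_iota => /andP[].
have := moves_leaf (IH _ (ltnW rM) l12 pw) l12 a12 (_ : _ && (orb b == _)) (erefl _).
rewrite bK -bo eqxx => /(_ isT)[v1 [v2 [b' [vE /andP[b'K /eqP b'o] bb']]]].
by apply: moves_trans bb' (moves_leaf_last _ _ _ _).
Qed.

Lemma adj_comm a b : 0 < a <= K -> 0 < b <= K -> far a b ->
  (adj K a * adj K b = adj K b * adj K a)%g.
Proof.
move=> aK bK ab; apply/permP=> x; apply: val_inj => /=; rewrite !permM.
rewrite !val_adj //; move: ab; rewrite /far.
by do !case: eqP; lia.
Qed.

Lemma move_word w v : cyc_move w v -> letters w ->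
  word K v = word K w \/
  exists2 a, a \in w & word K v = (adj K a * word K w * adj K (k - a))%g.
Proof.
case=> [w1 a b w2 ab|a w' /= /andP[aK _]].
  rewrite /is_word all_cat /= => /and4P[_ aK bK _]; left.
  by rewrite !word_cat !word_cons !mulgA -(mulgA _ (adj K b)) -adj_comm ?mulgA.
right; exists a; rewrite ?mem_head // -cats1 word_cat !word_cons /word big_nil mulg1.
by rewrite mulgA /adj tperm2 mul1g.
Qed.

Lemma w0_adj a : 0 < a <= K -> (adj K (k - a) = adj K a ^ w0 k)%g.
Proof.
move=> aK; rewrite /adj tpermJ !w0E tpermC; congr tperm; apply: val_inj => /=.
  by rewrite !inordK; lia.
by rewrite !inordK; lia.
Qed.

End Moves.

(** * Cycles on a subset *)

Section Embedding.
Variables n k : nat.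
Implicit Types (phi : 'I_k -> 'I_n) (tau : 'S_k) (sigma : 'S_n).

(** As [phi] is increasing, a full cycle [tau] is the cycle standardization of the cycle that
    [sigma] has on the image. *)
Definition embeds phi tau sigma : Prop :=
  [/\ forall i j : 'I_k, i < j -> phi i < phi j,
      forall i, sigma (phi i) = phi (tau i)
    & forall x, x \notin phi @: setT -> sigma x = x].

Variables (phi : 'I_k -> 'I_n) (tau : 'S_k) (sigma : 'S_n).
Hypothesis emb : embeds phi tau sigma.
Local Notation C := (phi @: setT).

Lemma embeds_ltn i j : (phi i < phi j) = (i < j).
Proof.
case: emb => mono _ _; have [/mono//|ji] := ltnP i j.
apply/negbTE; rewrite -leqNgt; move: ji; rewrite leq_eqVlt => /predU1P[/val_inj->//|/mono].
exact: ltnW.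
Qed.

Lemma embeds_inj : injective phi.
Proof.
move=> i j ij; apply: val_inj; have [lt|lt|//] := ltngtP i j.
  by move: lt; rewrite -embeds_ltn ij ltnn.
by move: lt; rewrite -embeds_ltn ij ltnn.
Qed.

Lemma card_embeds : #|C| = k.
Proof. by rewrite card_imset ?cardsT ?card_ord //; exact: embeds_inj. Qed.

Lemma embeds_mem i : phi i \in C.
Proof. by rewrite imset_f. Qed.

Lemma embeds_ge (i : 'I_k) : i <= phi i.
Proof.
rewrite -[leqLHS](@card_ord_lt k) ?[i <= k]ltnW // -[leqRHS](@card_ord_lt n) ?[phi i <= n]ltnW //.
rewrite -(card_imset _ embeds_inj); apply/subset_leq_card/subsetP=> _ /imsetP[j ji ->].
by move: ji; rewrite !inE embeds_ltn.
Qed.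

Lemma embeds_fix x : x \notin C -> sigma x = x.
Proof. by case: emb => _ _; apply. Qed.

Lemma embedsE i : sigma (phi i) = phi (tau i).
Proof. by case: emb. Qed.

Lemma embeds_stable x : x \in C -> sigma x \in C.
Proof. by case/imsetP=> i _ ->; rewrite embedsE embeds_mem. Qed.

(** Two fixed points form no inversion. A fixed point [f] is inverted with the points jumping over
    it upwards and with those jumping downwards, equally many by [crossing_down]. *)
Lemma embeds_length :
  coxeter_length sigma =
    coxeter_length tau + \sum_(f in ~: C) (crossing f sigma).*2.
Proof.
have lenE m (u : 'S_m) :
    coxeter_length u = \sum_(x < m) \sum_(y < m) ((x < y) && (u y < u x)).
  rewrite coxeter_length_sum; apply: eq_bigr => x _.
  by rewrite -sum1dep_card big_mkcond.
rewrite [LHS]lenE (bigID (mem C)) /=.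
rewrite [X in X + _](eq_bigr (fun x : 'I_n =>
    \sum_(y in C) ((x < y) && (sigma y < sigma x))
    + \sum_(y in ~: C) ((x < y) && (sigma y < sigma x)))); last first.
  move=> x _; rewrite (bigID (mem C)) /=; congr (_ + _).
  by apply: eq_bigl => y; rewrite inE.
rewrite big_split /= -addnA; congr (_ + _).
  rewrite lenE big_imset /=; last by move=> i j _ _; exact: embeds_inj.
  rewrite big_mkcond; apply: eq_bigr => i _; rewrite inE.
  rewrite big_imset /=; last by move=> a b _ _; exact: embeds_inj.
  rewrite big_mkcond; apply: eq_bigr => j _; rewrite inE.
  by rewrite !embedsE !embeds_ltn.
rewrite exchange_big /=; under [X in _ + X]eq_bigl => x do rewrite -in_setC.
rewrite -big_split; apply: eq_bigr => f /=; rewrite inE => fC; rewrite -addnn.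
have fE := embeds_fix fC; congr (_ + _).
  rewrite /crossing -sum1dep_card [RHS]big_mkcond [LHS]big_mkcond.
  apply: eq_bigr => x _; have [xC|xC] := ifPn.
    rewrite fE [f <= _]leq_eqVlt; case: eqP => [/val_inj fx|//].
    by move: fC; rewrite fx embeds_stable.
  by rewrite embeds_fix //; case: ifP => //; lia.
rewrite -crossing_down -sum1dep_card [RHS]big_mkcond; apply: eq_bigr => y _.
rewrite fE andbC [f <= _]leq_eqVlt; case: (eqVneq (f : nat) y) => [/val_inj <-|//].
by rewrite fE ltnn.
Qed.

(** The points crossing the cut and their images are disjoint subsets of the cycle, of equal
    size. *)
Lemma crossing_fix f : f \notin C -> crossing f sigma <= k./2.
Proof.
move=> fC; rewrite /crossing; set X := [set x | _].
have XC : X \subset C.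
  apply/subsetP=> x; rewrite inE; apply: contraLR => xC; rewrite embeds_fix //; lia.
have sXC : sigma @: X \subset C :\: X.
  apply/subsetP=> _ /imsetP[x xX ->]; rewrite inE embeds_stable ?(subsetP XC) // andbT.
  by move: xX; rewrite !inE; lia.
have := subset_leq_card sXC; rewrite card_imset; last exact: perm_inj.
have := subset_leq_card XC; rewrite cardsD (setIidPr XC) card_embeds.
by move: #|X| => c; lia.
Qed.

Lemma embeds_length_le : coxeter_length sigma <= coxeter_length tau + (n - k) * (k./2).*2.
Proof.
rewrite embeds_length leq_add2l.
have <- : #|~: C| = n - k by rewrite cardsCs setCK card_ord card_embeds.
rewrite -sum_nat_const; apply: leq_sum => f; rewrite inE => /crossing_fix.
by rewrite leq_double.
Qed.

Lemma embeds_length_ge :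
  (forall f, f \notin C -> k./2 <= crossing f sigma) <->
  coxeter_length tau + (n - k) * (k./2).*2 <= coxeter_length sigma.
Proof.
rewrite embeds_length leq_add2l.
have <- : #|~: C| = n - k by rewrite cardsCs setCK card_ord card_embeds.
rewrite -sum_nat_const; split=> [H|].
  by apply: leq_sum => f; rewrite inE => /H; rewrite leq_double.
move=> H f fC; rewrite leqNgt; apply/negP=> lt.
move: H; rewrite leqNgt => /negP; apply.
rewrite (bigD1 f) ?inE //= [ltnRHS](bigD1 f) ?inE //= -addSn.
apply: leq_add; first by rewrite ltn_double.
apply: leq_sum => x /andP[]; rewrite inE => /crossing_fix.
by rewrite leq_double.
Qed.

(** Condition (3) of the hook properties: [hook_mid k] equals [k./2] for either parity. *)
Definition outer : Prop := forall i : 'I_n, i < k./2 -> i \in C /\ rev_ord i \in C.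

(** The bound of [crossing_fix] must be attained at every fixed point, but one at position
    [i < k./2] from either end has only [i] points on its outer side. *)
Lemma length_outer :
  coxeter_length tau + (n - k) * (k./2).*2 <= coxeter_length sigma -> outer.
Proof.
move=> /embeds_length_ge H i im; split; apply/negPn/negP=> iC.
  have := H i iC; rewrite leqNgt => /negP; apply; apply: leq_trans im; rewrite ltnS.
  rewrite -[leqRHS](@card_ord_lt n) ?[i <= n]ltnW //.
  by apply/subset_leq_card/subsetP=> x; rewrite !inE => /andP[].
have := H _ iC; rewrite leqNgt => /negP; apply; apply: leq_trans im; rewrite ltnS.
rewrite -crossing_down -[leqRHS](@card_ord_lt n) ?[i <= n]ltnW //.
rewrite -[leqRHS](card_preimset _ (@rev_ord_inj n)).
apply/subset_leq_card/subsetP=> x; rewrite !inE => /andP[xi ix].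
rewrite ltn_neqAle; apply/andP; split; last by rewrite /= in ix *; lia.
apply: contraTneq xi => /val_inj xi; rewrite -xi in iC *.
by rewrite rev_ordK in iC *; rewrite embeds_fix // ltnn.
Qed.

End Embedding.

(** Symmetry under reversal, through which [outer_hi] follows from [outer_lo]. *)
Lemma embeds_rev n k (phi : 'I_k -> 'I_n) tau sigma : embeds phi tau sigma ->
  embeds (fun i => rev_ord (phi (rev_ord i))) (tau ^ w0 k)%g (sigma ^ w0 n)%g.
Proof.
move=> emb; have E i : w0 n (phi (w0 k i)) = rev_ord (phi (rev_ord i)) by rewrite !w0E.
have w0w0 m (x : 'I_m) : w0 m (w0 m x) = x by rewrite -permM w0K perm1.
have w0V m (x : 'I_m) : (w0 m)^-1%g x = w0 m x.
  by apply: (@perm_inj _ (w0 m)); rewrite permKV w0w0.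
have JE m (s : 'S_m) x : (s ^ w0 m)%g x = w0 m (s (w0 m x)).
  by rewrite conjgE !permM w0V.
split=> [i j ij|i|x xC]; first 1 last.
- by rewrite -!E !JE !w0w0 (embedsE emb).
- rewrite JE (embeds_fix emb) ?w0w0 //.
  apply: contra xC => /imsetP[i _ iE]; apply/imsetP; exists (rev_ord i) => //.
  by rewrite rev_ordK -iE w0E rev_ordK.
have := embeds_ltn emb (rev_ord j) (rev_ord i); rewrite /=.
have := ltn_ord (phi (rev_ord j)); have := ltn_ord i; have := ltn_ord j.
move: (phi (rev_ord i)) (phi (rev_ord j)) => [a an] [b bn] /=; lia.
Qed.

Section Outer.
Variables n k : nat.
Implicit Types (phi : 'I_k -> 'I_n) (tau : 'S_k) (sigma : 'S_n).

Lemma outer_lo phi tau sigma (i : 'I_k) : embeds phi tau sigma -> outer phi ->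
  i < k./2 -> phi i = i :> nat.
Proof.
move=> emb out; have [m] := ubnP i; elim: m i => // m IH i; rewrite ltnS => im ik.
have := embeds_ge emb i; have iphi := embeds_ge emb i.
have ltin : i < n by apply: leq_ltn_trans (ltn_ord (phi i)).
have [/imsetP[j _ ij] _] := out (Ordinal ltin) ik.
have jE : phi j = i :> nat by rewrite -ij.
have [ji|ij'|/val_inj ji] := ltngtP j i; last by move: jE; rewrite ji.
  have := IH j (leq_trans ji im) (ltn_trans ji ik); lia.
by have := embeds_ltn emb i j; rewrite jE ij'; lia.
Qed.

Lemma outer_hi phi tau sigma (i : 'I_k) : embeds phi tau sigma -> outer phi ->
  k - k./2 <= i -> phi i = i + (n - k) :> nat.
Proof.
move=> emb out ik; have emb' := embeds_rev emb.
have out' : outer (fun i => rev_ord (phi (rev_ord i))).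
  move=> x xm; have [/imsetP[a _ aE] /imsetP[b _ bE]] := out x xm.
  split; apply/imsetP.
    by exists (rev_ord b) => //; rewrite rev_ordK -bE rev_ordK.
  by exists (rev_ord a) => //; rewrite rev_ordK -aE.
have := @outer_lo _ _ _ (rev_ord i) emb' out'; rewrite rev_ordK /=.
have := ltn_ord i; have := ltn_ord (phi i).
have : k <= n by rewrite -(card_embeds emb) -[leqRHS]card_ord max_card.
lia.
Qed.

(** All fixed points lie between the two outer blocks of size [k./2], and oscillation sends one
    whole block to the other, over each of them. *)
Lemma oscillating_length phi tau sigma : embeds phi tau sigma -> outer phi ->
    oscillating_cycle tau ->
  coxeter_length tau + (n - k) * (k./2).*2 <= coxeter_length sigma.
Proof.
move=> emb out osc; apply/(embeds_length_ge emb) => f fC.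
have [m [mk km lo hi]] := oscillating_cycle_bounds osc.
have flo : k./2 <= f by rewrite leqNgt; apply: contra fC => /out[].
have fhi : f < n - k./2.
  rewrite ltnNge; apply: contra fC => nf; rewrite -[f]rev_ordK.
  by apply: (out _ _).2; have := ltn_ord f; rewrite /=; lia.
(* In the first case the lower block goes up; in the second the upper block comes down, counted
   through [crossing_down]. *)
have [mE|mE] : m = k./2 \/ m = k - k./2 by lia.
  have <- : #|[set i : 'I_k | i < k./2]| = k./2 by rewrite card_ord_lt; lia.
  rewrite -(card_imset _ (embeds_inj emb)).
  apply/subset_leq_card/subsetP=> _ /imsetP[i im ->]; rewrite inE in im.
  rewrite inE (embedsE emb) (outer_lo emb out im).
  have ti : k - m <= tau i by apply: lo; rewrite mE.
  rewrite (outer_hi emb out) //; last by lia.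
  by rewrite (leq_trans im flo); lia.
have <- : #|[set i : 'I_k | k - k./2 <= i < k]| = k./2 by rewrite card_ord_itv; lia.
rewrite -crossing_down -(card_imset _ (embeds_inj emb)).
apply/subset_leq_card/subsetP=> _ /imsetP[i im ->].
have {}im : k - k./2 <= i by move: im; rewrite inE => /andP[].
rewrite inE (embedsE emb) (outer_hi emb out im).
have ti : tau i < k - m by apply: hi; rewrite mE.
rewrite (outer_lo emb out) //; last by lia.
lia.
Qed.

End Outer.

(** * Orbits, cycle standardization and the hook properties *)

Lemma porbit_stable (T : finType) (s : {perm T}) (A : {set T}) x :
  (forall y, y \in A -> s y \in A) -> x \in A -> porbit s x \subset A.
Proof.
move=> sA xA; apply/subsetP=> _ /porbitP[i ->].
by elim: i => [|i IH]; rewrite ?perm1 // expgSr permM sA.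
Qed.

Lemma order_porbit (T : finType) (s : {perm T}) x : fingraph.order s x = #|porbit s x|.
Proof.
apply: eq_card => y; rewrite porbit_traject; apply/idP/idP => [xy|/trajectP[i _ ->]].
  rewrite -porbit_traject -(iter_findex xy) -permX; exact: mem_porbit.
exact: fconnect_iter.
Qed.

Lemma mem_orbit_porbit (T : finType) (s : {perm T}) x :
  fingraph.orbit s x =i porbit s x.
Proof. by move=> y; rewrite porbit_traject -order_porbit. Qed.

Lemma full_cycle_porbit (T : finType) (s : {perm T}) x :
  full_cycle s -> porbit s x = setT.
Proof.
move=> full; apply: full; first by apply/set0Pn; exists x; exact: porbit_id.
by move=> _ /porbitP[i ->]; rewrite -permM -expgSr mem_porbit.
Qed.

Lemma oscillating_cycle1 (tau : 'S_1) : oscillating_cycle tau.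
Proof.
exists 1; split=> //; first exact: Or33.
apply/imset_itv => //; apply/eqP; rewrite cards_eq0 -subset0; apply/subsetP=> x.
by rewrite inE; case: ((tau * w0 1)%g x) => m /=; lia.
Qed.

(** The cycle runs through all of ['I_k] and [phi] is increasing, so the rank of an entry is its
    preimage under [phi]. *)
Lemma cst_traject n k (tau : 'S_k) (phi : 'I_k -> 'I_n) (i : 'I_k) (t : k.-tuple 'I_n) :
    (forall a b, (phi a <= phi b) = (a <= b)) -> injective phi -> full_cycle tau ->
    (forall j : 'I_k, tnth t j = phi (iter j tau i)) -> uniq t ->
  cst t = tau.
Proof.
move=> phi_le phi_inj full tE ut; pose d (j : 'I_k) := iter j tau i.
have dinj : injective d.
  move=> a b dab; apply: (tuple_uniqP _ ut); rewrite !tE; congr phi; exact: dab.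
have rankE j : cst_rank t j = d j.
  apply: val_inj => /=.
  rewrite (eq_card (_ : _ =i d @^-1: [set y : 'I_k | y < (d j).+1])); last first.
    by move=> a; rewrite !inE !tE phi_le.
  by rewrite card_preimset // card_ord_lt.
have sE : [seq cst_rank t j | j <- enum 'I_k] = fingraph.orbit tau i.
  rewrite (eq_map rankE) /fingraph.orbit order_porbit full_cycle_porbit //.
  rewrite cardsT card_ord; apply: (@eq_from_nth _ i); first by
    rewrite size_map size_enum_ord size_traject.
  move=> j; rewrite size_map size_enum_ord => jk.
  by rewrite (nth_map i) ?size_enum_ord // nth_traject // /d nth_enum_ord.
apply/permP=> x; rewrite /cst sE cycle_permE ?orbit_uniq //.
have xi : x \in fingraph.orbit tau i by rewrite mem_orbit_porbit full_cycle_porbit ?inE.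
have cyc : fcycle tau (fingraph.orbit tau i) by apply: cycle_orbit; exact: perm_inj.
by apply/esym/eqP; exact: next_cycle cyc xi.
Qed.

Section HookProperties.
Variables n k : nat.
Variables (phi : 'I_k -> 'I_n) (tau : 'S_k) (sigma : 'S_n).
Hypotheses (emb : embeds phi tau sigma) (full : full_cycle tau) (k0 : 0 < k).
Local Notation C := (phi @: setT).

Lemma embeds_iter j i : iter j sigma (phi i) = phi (iter j tau i).
Proof. by elim: j => //= j ->; rewrite (embedsE emb). Qed.

Lemma embeds_porbit i : porbit sigma (phi i) = C.
Proof.
apply/eqP; rewrite eqEsubset porbit_stable ?embeds_mem //; last first.
  by move=> y; exact: (embeds_stable emb).
apply/subsetP=> _ /imsetP[j _ ->].
have := in_setT j; rewrite -(full_cycle_porbit i full) => /porbitP[m ->].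
by rewrite permX -embeds_iter -permX mem_porbit.
Qed.

Lemma fix_porbit x : x \notin C -> porbit sigma x = [set x].
Proof.
move=> xC; apply/eqP; rewrite eqEsubset sub1set porbit_id andbT.
by apply: porbit_stable; rewrite ?set11 // => y /set1P->; rewrite (embeds_fix emb) ?set11.
Qed.

(** The length [m] is a variable so that its equality with [k], which holds only by proof, can be
    substituted. *)
Lemma cst_embeds m (t : m.-tuple 'I_n) i (P : forall m, 'S_m -> Prop) :
  tval t = fingraph.orbit sigma (phi i) -> P m (cst t) <-> P k tau.
Proof.
move=> tE; have mk : m = k.
  by rewrite -(size_tuple t) tE size_orbit order_porbit embeds_porbit (card_embeds emb).
subst m; rewrite (@cst_traject _ _ tau phi i t) //.
- by move=> a b; rewrite leqNgt (embeds_ltn emb) -leqNgt.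
- exact: embeds_inj emb.
- move=> j; rewrite (tnth_nth (phi i)) tE nth_traject ?embeds_iter //.
  by rewrite order_porbit embeds_porbit (card_embeds emb).
- by rewrite tE orbit_uniq.
Qed.

Lemma cst_fix m (t : m.-tuple 'I_n) x :
  x \notin C -> tval t = fingraph.orbit sigma x -> m = 1.
Proof.
move=> xC tE.
by rewrite -(size_tuple t) tE size_orbit order_porbit fix_porbit ?cards1.
Qed.

Lemma hook_propertiesP : hook_properties sigma k <->
  [/\ oscillating_cycle tau, connected_intervals_cycle tau & outer phi].
Proof.
have mid : hook_mid k = k./2 by rewrite /hook_mid; case: ifP; lia.
have i0 : 'I_k by exists 0.
split=> [[osc conn hook]|[osc conn out]].
  split.
  - exact: (@cst_embeds _ (in_tuple _) i0 (@oscillating_cycle) (erefl _)).1 (osc _).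
  - exact: (@cst_embeds _ (in_tuple _) i0 (@connected_intervals_cycle) (erefl _)).1 (conn _).
  move=> i im; have [k1|k1] := leqP k 1; first by lia.
  have [C' [C'orbit_index C'k out]] := hook k1.
  have C'E : C' = C.
    have /imsetP[x _ xE] := C'orbit_index; have [/imsetP[j _ xj]|xC] := boolP (x \in C).
      by rewrite xE xj embeds_porbit.
    by move: C'k k1; rewrite xE fix_porbit // cards1; lia.
  by rewrite -C'E; apply: out; rewrite inE mid.
split=> [x|x|k1].
- have [/imsetP[i _ ->]|xC] := boolP (x \in C).
    exact: (@cst_embeds _ (in_tuple _) i (@oscillating_cycle) (erefl _)).2 osc.
  move: (in_tuple _) (cst_fix xC (erefl (tval (in_tuple (fingraph.orbit sigma x))))).
  by move: (size _) => m t m1; subst m; exact: oscillating_cycle1.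
- have [/imsetP[i _ ->]|xC] := boolP (x \in C).
    exact: (@cst_embeds _ (in_tuple _) i (@connected_intervals_cycle) (erefl _)).2 conn.
  (* A trivial cycle has length 1, which leaves no [j] to check. *)
  move=> j; have := cst_fix xC (erefl (tval (in_tuple (fingraph.orbit sigma x)))); lia.
exists C; split.
- by apply/imsetP; exists (phi i0); rewrite ?embeds_porbit.
- exact: card_embeds emb.
- by move=> i; rewrite inE mid => im; apply: out; lia.
Qed.

End HookProperties.

Lemma embeds_exists n k (sigma : 'S_n) : has_cycle_type sigma (hook n k) ->
  exists phi (tau : 'S_k), embeds phi tau sigma /\ full_cycle tau.
Proof.
move=> ct; have : k \in [seq #|C| | C : {set 'I_n} in porbits sigma].
  by rewrite (perm_mem ct) mem_head.
case/imageP=> C Corb kC.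
(* Removing the orbit [C] from the list of orbits removes one [k] from the sizes, so all remaining
   orbits are singletons. *)
have fix1 x : x \notin C -> sigma x = x.
  move=> xC; have : #|porbit sigma x| = 1.
    have xorb : porbit sigma x \in rem C (enum (porbits sigma)).
      rewrite mem_rem_uniq ?enum_uniq // inE mem_enum imset_f // andbT.
      by apply: contraNneq xC => <-; exact: porbit_id.
    have /(map_f (fun C : {set 'I_n} => #|C|)) := xorb.
    rewrite (perm_mem (_ : perm_eq _ (nseq (n - k) 1))); first by rewrite mem_nseq => /andP[_ /eqP].
    rewrite -(perm_cons k); apply: perm_trans ct.
    rewrite {1}kC -(map_cons (fun C : {set 'I_n} => #|C|)) perm_map //.
    by rewrite perm_sym perm_to_rem // mem_enum.
  move/eqP/cards1P=> [y yE]; have := porbit_id sigma x; have := mem_porbit sigma 1 x.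
  by rewrite yE expg1 !inE => /eqP-> /eqP->.
have Csig x : (sigma x \in C) = (x \in C).
  case/imsetP: Corb => z _ ->; rewrite !(porbit_sym _ _ z).
  by rewrite -[sigma x]/((sigma ^+ 1)%g x) porbit_perm.
subst k; pose phi (i : 'I_#|C|) : 'I_n := enum_val i.
have phiC i : phi i \in C := enum_valP i.
have surj x : x \in C -> exists i, x = phi i.
  by move=> xC; exists (enum_rank_in xC x); rewrite /phi enum_rankK_in.
have [f fE] : exists f : 'I_#|C| -> 'I_#|C|, forall i, phi (f i) = sigma (phi i).
  apply: (fin_all_exists (P := fun i j => phi j = sigma (phi i))) => i.
  by have [|j ->] := surj (sigma (phi i)); [rewrite Csig | exists j].
have finj : injective f.
  by move=> i j /(congr1 phi); rewrite !fE => /perm_inj; exact: enum_val_inj.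
have CE : phi @: setT = C.
  apply/setP=> x; apply/imsetP/idP => [[i _ ->]//|/surj[i ->]]; by exists i.
exists phi, (perm finj); split.
  split=> [i j ij|i|x]; [|by rewrite permE fE|by rewrite CE; exact: fix1].
  have: sorted ltn (map val (enum C)).
    rewrite /enum_mem; apply: (subseq_sorted ltn_trans _ (iota_ltn_sorted 0 n)).
    by rewrite -val_enum_ord; apply: map_subseq; rewrite enumT; exact: filter_subseq.
  rewrite sorted_map => /(sorted_ltn_nth _ (phi i)) C_sorted.
  rewrite /phi !(enum_val_nth (phi i)); apply: C_sorted => //.
  - by move=> x y z; exact: ltn_trans.
  - by rewrite inE -cardE.
  - by rewrite inE -cardE.
move=> A /set0Pn[a aA] stA; apply/setP=> i; rewrite inE.
have : porbit sigma (phi a) \subset phi @: A.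
  apply: porbit_stable; last exact: imset_f.
  by move=> _ /imsetP[b bA ->]; rewrite -fE; apply: imset_f; rewrite -(permE finj) stA.
have /imsetP[z _ CE'] := Corb.
have -> : porbit sigma (phi a) = porbit sigma z.
  by apply/eqP; rewrite eq_porbit_mem -CE'.
by rewrite -CE' => /subsetP/(_ _ (phiC i))/imsetP[b bA] /enum_val_inj->.
Qed.

(** * Lifting conjugations *)

Section Approx.
Variable n : nat.
Implicit Types w : 'S_n.

Lemma cox_arrow_length w w' : cox_arrow w w' -> coxeter_length w' <= coxeter_length w.
Proof.
case/connectP=> p; elim: p w => [|v p IH] w /=; first by move=> _ ->.
case/andP=> /existsP[i /existsP[j /and3P[_ _ vw]]] pv E.
exact: leq_trans (IH v pv E) vw.
Qed.

Lemma cox_approx_length w w' : cox_approx w w' -> coxeter_length w = coxeter_length w'.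
Proof.
case/andP=> /cox_arrow_length h1 /cox_arrow_length h2.
by apply/eqP; rewrite eqn_leq h1 h2.
Qed.

Lemma cox_approx_refl w : cox_approx w w.
Proof. by rewrite /cox_approx /cox_arrow connect0. Qed.

Lemma cox_approx_sym w w' : cox_approx w w' = cox_approx w' w.
Proof. exact: andbC. Qed.

Lemma cox_approx_trans w1 w2 w3 :
  cox_approx w1 w2 -> cox_approx w2 w3 -> cox_approx w1 w3.
Proof.
case/andP=> w12 w21 /andP[w23 w32]; apply/andP.
by split; [exact: connect_trans w12 w23 | exact: connect_trans w32 w21].
Qed.

Lemma cox_approx_conj w (i j : 'I_n) : j = i.+1 :> nat ->
    coxeter_length (tperm i j * w * tperm i j) = coxeter_length w ->
  cox_approx w (tperm i j * w * tperm i j)%g.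
Proof.
move=> ij E; apply/andP; split; apply: connect1; apply/existsP; exists i; apply/existsP; exists j.
  by rewrite ij !eqxx E leqnn.
by rewrite ij eqxx E leqnn !mulgA tperm2 mul1g -mulgA tperm2 mulg1 eqxx.
Qed.

End Approx.

Section Lift.
Variables n K : nat.
Local Notation k := K.+1.
Implicit Types (phi : 'I_k -> 'I_n) (tau : 'S_k) (sigma : 'S_n) (w : seq nat).

Definition max_length : nat := pairs_count k - K./2 + (n - k) * (k./2).*2.

(** Cycle and fixed points each obey an upper bound and [max_length] is the sum of the two, so
    attaining it means tightness of the cycle and [outer]. *)
Lemma hook_max phi tau sigma : embeds phi tau sigma -> full_cycle tau ->
  [/\ oscillating_cycle tau, connected_intervals_cycle tau & outer phi]
  <-> max_length <= coxeter_length sigma.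
Proof.
move=> emb full; have := coxeter_length_w0 tau.
have := length_lower full; rewrite /max_length => lo pairs.
split=> [[osc conn out]|max].
  apply: leq_trans (oscillating_length emb out osc); rewrite leq_add2r.
  have := tight_length full (tight_hook_cycle osc conn); rewrite /=; lia.
have len_tau : coxeter_length tau = pairs_count k - K./2.
  have := embeds_length_le emb; lia.
have t : tight (tau * w0 k) by apply: length_tight => //; lia.
split; [exact: oscillating_tight | exact: connected_intervals_tight |].
by apply: (length_outer emb); rewrite len_tau.
Qed.

(* The cycle of [sigma] is the image under [phi] of a cycle [tau], and [w] spells
   u = [tau * w0] with exactly one letter for each pair {s_j, s_(k - j)}, 2 j < k. *)
Definition codes w phi sigma : Prop :=
  [/\ is_word K w, perm_eq (map (orbit_index K) w) (iota 1 K./2),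
      embeds phi (word K w * w0 k)%g sigma, full_cycle (word K w * w0 k)%g & outer phi].

Lemma codes_length w phi sigma : codes w phi sigma -> coxeter_length sigma = max_length.
Proof.
case=> lw pw emb full out; apply/eqP; rewrite eqn_leq; apply/andP; split.
  apply: leq_trans (embeds_length_le emb) _; rewrite leq_add2r.
  have := coxeter_length_w0 (word K w * w0 k); have := length_lower full; lia.
have E : (word K w * w0 k * w0 k)%g = word K w by rewrite -mulgA w0K mulg1.
have t : tight (word K w * w0 k * w0 k)%g.
  apply: length_tight => //; apply/eqP; rewrite eqn_leq length_lower // andbT E.
  by rewrite -(size_iota 1 K./2) -(perm_size pw) size_map coxeter_length_word.
apply: (hook_max emb full).1; split=> //.
  exact: oscillating_tight t.
exact: connected_intervals_tight t.
Qed.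

(** Both ends have the maximal length, so the step is legal in either direction. *)
Lemma codes_conj w v phi psi sigma (i j : 'I_n) : j = i.+1 :> nat ->
    codes w phi sigma -> codes v psi (tperm i j * sigma * tperm i j)%g ->
  cox_approx sigma (tperm i j * sigma * tperm i j)%g.
Proof.
by move=> ij /codes_length cw /codes_length cv; apply: cox_approx_conj; rewrite ?cv ?cw.
Qed.

Lemma codes_leq w phi sigma : codes w phi sigma -> k <= n.
Proof. by case=> _ _ emb _ _; rewrite -(card_embeds emb) -[leqRHS]card_ord max_card. Qed.

Lemma center_bounds phi tau sigma : embeds phi tau sigma -> outer phi -> odd k ->
  k./2 <= phi (inord k./2) < n - k./2.
Proof.
move=> emb out kodd; have kn : k <= n.
  by rewrite -(card_embeds emb) -[leqRHS]card_ord max_card.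
have mid : (inord k./2 : 'I_k) = k./2 :> nat by rewrite inordK; lia.
have := embeds_ge emb (inord k./2); rewrite mid => ->; rewrite andTb.
have [k1|k1] := leqP k 1; first by move: (phi _) => [x xn]; rewrite [nat_of_ord _]/=; lia.
have m1 : (inord k./2.+1 : 'I_k) = k./2.+1 :> nat by rewrite inordK; lia.
have hi : phi (inord k./2.+1) = k./2.+1 + (n - k) :> nat.
  by rewrite (outer_hi emb out) m1 //; lia.
have := embeds_ltn emb (inord k./2) (inord k./2.+1); rewrite mid m1 ltnSn hi.
by move: (phi _) => [x xn]; rewrite [nat_of_ord _]/=; lia.
Qed.

(** For odd [k], [outer] fixes [phi] everywhere but at the middle point. That point can slide past a
    neighbouring fixed point without changing [tau], hence with the same word. *)
Lemma center_step w phi sigma (c d : 'I_n) : odd k -> codes w phi sigma ->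
    phi (inord k./2) = c -> k./2 <= d < n - k./2 -> d = c.+1 :> nat \/ c = d.+1 :> nat ->
  exists psi sigma', [/\ cox_approx sigma sigma', codes w psi sigma' & psi (inord k./2) = d].
Proof.
move=> kodd cw phic dk cd; have kn := codes_leq cw.
case: (cw) => lw pw emb full out; pose t := tperm c d.
have mid : (inord k./2 : 'I_k) = k./2 :> nat by rewrite inordK; lia.
have lo (i : 'I_k) : i < k./2 -> phi i = i :> nat by exact: outer_lo emb out.
have hi (i : 'I_k) : k./2 < i -> phi i = i + (n - k) :> nat.
  by move=> im; apply: (outer_hi emb out); lia.
have cb : k./2 <= c < n - k./2 by rewrite -phic; exact: center_bounds emb out kodd.
have cases (i : 'I_k) : [\/ i < k./2, i = inord k./2 | k./2 < i].
  have [im|im|im] := ltngtP i k./2; [exact: Or31 | exact: Or33 | apply: Or32].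
  by apply: val_inj; rewrite /= mid.
have tphi (i : 'I_k) : i != inord k./2 -> t (phi i) = phi i.
  move=> im; apply: tpermD; first by rewrite -phic (inj_eq (embeds_inj emb)) eq_sym.
  have ik := ltn_ord i; apply/eqP=> /(congr1 val) /= dE.
  case: (cases i) => [ilt|iE|ilt]; first by have := lo i ilt; lia.
    by rewrite iE eqxx in im.
  by have := hi i ilt; lia.
have tc : t (phi (inord k./2)) = d by rewrite phic /t tpermL.
have lo' (i : 'I_k) : i < k./2 -> t (phi i) = i :> nat.
  by move=> im; rewrite tphi ?lo // -(inj_eq val_inj) /= mid; lia.
have hi' (i : 'I_k) : k./2 < i -> t (phi i) = i + (n - k) :> nat.
  by move=> im; rewrite tphi ?hi // -(inj_eq val_inj) /= mid; lia.
have cw' : codes w (fun i => t (phi i)) (t * sigma * t)%g.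
  have outC x : x \in phi @: setT -> (x < k./2) || (n - k./2 <= x) ->
      x \in (fun i => t (phi i)) @: setT.
    case/imsetP=> i _ -> xlo; apply/imsetP; exists i => //; rewrite tphi //.
    apply: contraTneq xlo => ->; rewrite phic.
    by lia.
  split=> //; last first.
    move=> i im; have [iC riC] := out i im.
    by split; apply: outC => //=; [rewrite im | apply/orP; right; lia].
  split=> [i j ij|i|x xC].
  - have ik := ltn_ord i; have jk := ltn_ord j.
    case: (cases i) (cases j) => [il|iE|il] [jl|jE|jl].
    + by rewrite !lo'.
    + by rewrite lo' // jE tc; lia.
    + by rewrite lo' // hi'; lia.
    + by move: ij; rewrite iE mid; lia.
    + by move: ij; rewrite iE jE ltnn.
    + by rewrite iE tc hi'; lia.
    + by lia.
    + by move: ij; rewrite jE mid; lia.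
    + by rewrite !hi'; lia.
  - by rewrite -(embedsE emb) !permM tpermK.
  rewrite !permM (embeds_fix emb) ?tpermK //.
  by apply: contra xC => /imsetP[i _ iE]; apply/imsetP; exists i; rewrite // -iE tpermK.
exists (fun i => t (phi i)), (t * sigma * t)%g; split=> //.
case: cd => [dE|cE]; first exact: codes_conj cw cw'.
by move: cw'; rewrite /t tpermC => cw'; exact: codes_conj cw cw'.
Qed.

Lemma center_move w phi sigma (d : 'I_n) : odd k -> codes w phi sigma ->
    k./2 <= d < n - k./2 ->
  exists psi sigma', [/\ cox_approx sigma sigma', codes w psi sigma' & psi (inord k./2) = d].
Proof.
move=> kodd + dk.
have [N] := ubnP ((phi (inord k./2) - d) + (d - phi (inord k./2))).
elim: N phi sigma => // N IH phi sigma; rewrite ltnS => cN cw.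
have cb : k./2 <= phi (inord k./2) < n - k./2.
  by case: cw => _ _ emb _ out; exact: center_bounds emb out kodd.
have [/val_inj cd|cd] := eqVneq (phi (inord k./2) : nat) d.
  by exists phi, sigma; split=> //; exact: cox_approx_refl.
have [c' cc' c'd] : exists2 c' : 'I_n, k./2 <= c' < n - k./2 /\
    (c' = (phi (inord k./2)).+1 :> nat \/ phi (inord k./2) = c'.+1 :> nat) &
    (c' - d) + (d - c') < N.
  have dn := ltn_ord d; have [lt|gt|eq] := ltngtP (phi (inord k./2)) d.
  - have lt1 : (phi (inord k./2)).+1 < n by lia.
    by exists (Ordinal lt1); rewrite (_ : Ordinal lt1 = (phi (inord k./2)).+1 :> nat) //; lia.
  - have lt1 : (phi (inord k./2)).-1 < n by lia.
    by exists (Ordinal lt1); rewrite (_ : Ordinal lt1 = (phi (inord k./2)).-1 :> nat) //; lia.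
  - by rewrite eq eqxx in cd.
have [psi [sigma1 [s1 cw1 psic]]] := center_step kodd cw (erefl _) cc'.1 cc'.2.
have [|psi2 [sigma2 [s2 cw2 psi2d]]] := IH psi sigma1 _ cw1; first by rewrite psic.
by exists psi2, sigma2; split=> //; exact: cox_approx_trans s1 s2.
Qed.

(** When [phi] takes consecutive values at [a.-1] and [a], conjugating [tau] by [adj a] amounts to
    conjugating [sigma] by a simple transposition. *)
Lemma adj_step w v phi sigma a : cyc_move K w v -> codes w phi sigma -> 0 < a <= K ->
    word K v = (adj K a * word K w * adj K (k - a))%g ->
    phi (inord a) = (phi (inord a.-1)).+1 :> nat ->
  exists sigma', cox_approx sigma sigma' /\ codes v phi sigma'.
Proof.
move=> wv cw aK E adj_phi; case: (cw) => lw pw emb full out.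
set t := tperm (phi (inord a.-1)) (phi (inord a)).
have tphi i : t (phi i) = phi (adj K a i) by rewrite /t (inj_tperm _ _ _ (embeds_inj emb)).
have tau_v : (word K v * w0 k = adj K a * (word K w * w0 k) * adj K a)%g.
  rewrite E (w0_adj aK) conjgE -!mulgA w0K mulg1.
  by rewrite (_ : (w0 k)^-1 = w0 k)%g // -[LHS]mulg1 -(w0K k) mulKg.
have cv : codes v phi (t * sigma * t)%g.
  split=> //.
  - exact: move_letters wv lw.
  - exact: perm_trans (move_orbs wv lw) pw.
  - split=> [i j|i|x xC].
    + by rewrite (embeds_ltn emb).
    + by rewrite tau_v !permM tphi (embedsE emb) tphi !permM.
    + have tx : t x = x.
        by apply: tpermD; apply: contraNneq xC => <-; exact: imset_f.
      by rewrite !permM tx (embeds_fix emb).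
  have -> : (word K v * w0 k = (word K w * w0 k) ^ adj K a)%g.
    by rewrite tau_v conjgE /adj tpermV -[LHS]mulgA.
  exact: full_cycle_conj.
by exists (t * sigma * t)%g; split=> //; exact: codes_conj adj_phi cw cv.
Qed.

Lemma codes_move w v phi sigma : cyc_move K w v -> codes w phi sigma ->
  exists psi sigma', cox_approx sigma sigma' /\ codes v psi sigma'.
Proof.
move=> wv cw; case: (cw) => lw pw emb full out.
case: (move_word wv lw) => [E|[a aw E]].
  exists phi, sigma; split; first exact: cox_approx_refl.
  by split; rewrite ?E //; [exact: move_letters wv lw | exact: perm_trans (move_orbs wv lw) pw].
have kn := codes_leq cw; have aK : 0 < a <= K by exact: (allP lw).
(* For even [k] the values of [phi] may jump only between the two blocks, that is at the letter
   [k / 2], which the word avoids. *)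
have mk : a != k./2 \/ odd k.
  have [kodd|keven] := boolP (odd k); [by right | left].
  have : orbit_index K a \in iota 1 K./2 by rewrite -(perm_mem pw) map_f.
  by rewrite mem_iota /orbit_index; lia.
have a1 : (inord a.-1 : 'I_k) = a.-1 :> nat by rewrite inordK; lia.
have a2 : (inord a : 'I_k) = a :> nat by rewrite inordK; lia.
have [kodd|keven] := boolP (odd k); last first.
  have am : a != k./2 by case: mk => // kodd; rewrite kodd in keven.
  have [sigma' [s' c']] : exists sigma', cox_approx sigma sigma' /\ codes v phi sigma'.
    apply: (adj_step wv cw aK E); have [lt|ge] := ltnP a k./2.
      by rewrite !(outer_lo emb out) ?a1 ?a2; lia.
    by rewrite !(outer_hi emb out) ?a1 ?a2; lia.
  by exists phi, sigma'.
(* The middle point is moved next to the block where [adj a] acts, so that the two values exchanged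
   are consecutive. *)
have dlt : (if a <= k./2 then k./2 else n - k./2.+1) < n by case: ifP; lia.
have [|psi [sigma1 [s1 cw1 psid]]] := center_move (d := Ordinal dlt) kodd cw.
  by rewrite [nat_of_ord _]/=; case: ifP; lia.
have mid : (inord k./2 : 'I_k) = k./2 :> nat by rewrite inordK; lia.
have [sigma' [s' c']] : exists sigma', cox_approx sigma1 sigma' /\ codes v psi sigma'.
  case: (cw1) => _ _ emb1 _ out1.
  have lo (i : 'I_k) : i < k./2 -> psi i = i :> nat by exact: outer_lo emb1 out1.
  have hi (i : 'I_k) : k./2 < i -> psi i = i + (n - k) :> nat.
    by move=> im; apply: (outer_hi emb1 out1); lia.
  have {}psid : psi (inord k./2) = (if a <= k./2 then k./2 else n - k./2.+1) :> nat.
    by rewrite psid.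
  apply: (adj_step wv cw1 aK E); have [lt|gt|am] := ltngtP a k./2.
  - by rewrite !lo ?a1 ?a2; lia.
  - rewrite hi ?a2 //; have [am|am] := eqVneq a k./2.+1.
      have -> : (inord a.-1 : 'I_k) = inord k./2 by congr inord; lia.
      by rewrite psid; case: ifP; lia.
    by rewrite hi ?a1; lia.
  - have -> : (inord a : 'I_k) = inord k./2 by rewrite am.
    by rewrite psid lo ?a1; [case: ifP; lia | lia].
by exists psi, sigma'; split=> //; exact: cox_approx_trans s1 s'.
Qed.

Lemma codes_moves w v phi sigma : cyc_moves K w v -> codes w phi sigma ->
  exists psi sigma', cox_approx sigma sigma' /\ codes v psi sigma'.
Proof.
move=> wv; elim: wv phi sigma => [w' phi sigma cw|w1 w2 w3 w12 _ IH phi sigma cw].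
  by exists phi, sigma; split=> //; exact: cox_approx_refl.
have [psi [sigma1 [s1 c1]]] := codes_move w12 cw.
have [psi2 [sigma2 [s2 c2]]] := IH _ _ c1.
by exists psi2, sigma2; split=> //; exact: cox_approx_trans s1 s2.
Qed.

End Lift.

(** * The stair form and its word *)

Lemma next_uniq_nth (T : eqType) (x0 : T) (s : seq T) j : uniq s -> j < size s ->
  next s (nth x0 s j) = nth x0 s (j.+1 %% size s).
Proof.
case: s => // y p us js; rewrite next_nth mem_nth // index_uniq //.
move: js; rewrite /= ltnS leq_eqVlt => /predU1P[->|jp].
  by rewrite modnn nth_default.
by rewrite modn_small ?ltnS // (set_nth_default x0).
Qed.

Lemma cycle_perm_small (T : finType) (c : seq T) : size c <= 1 -> cycle_perm c = 1%g.
Proof.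
case: c => [|y [|//]] _; apply/permP=> x; rewrite cycle_permE // perm1 //=.
by case: eqP.
Qed.

Section Stair.
Variable n : nat.

(* The value of x_(j + 1), 0-based. *)
Definition stair (j : nat) : nat := if odd j then n - j./2.+1 else j./2.

Lemma nth_stair (x0 : 'I_n) j : j < n -> nth x0 (stair_seq n) j = stair j :> nat.
Proof.
move=> jn; rewrite (nth_map (Ordinal jn)) ?size_enum_ord //.
by rewrite (fun_if val) /= nth_enum_ord //.
Qed.

Lemma size_stair_seq : size (stair_seq n) = n.
Proof. by rewrite size_map size_enum_ord. Qed.

Lemma uniq_stair_seq : uniq (stair_seq n).
Proof.
have [->|n0] := posnP n; first by rewrite /stair_seq; case: (enum _) (size_enum_ord 0).
apply/(uniqP (Ordinal n0)) => i j; rewrite !inE size_stair_seq => iN jN.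
move/(congr1 (@nat_of_ord n)); rewrite !nth_stair // /stair.
by case: ifP; case: ifP; lia.
Qed.

(** Every block after the first is a singleton and contributes the identity. *)
Lemma stair_permE k : stair_perm n (hook n k) = cycle_perm (take k (stair_seq n)).
Proof.
rewrite /stair_perm /hook /= big_cons big1_seq ?mulg1 // => d /andP[_].
move: (drop _ _) => s ds; apply: cycle_perm_small; move: (n - k) s ds.
elim=> [|m IH] s //=; rewrite inE => /predU1P[->|/IH//].
by rewrite size_take; case: ifP; lia.
Qed.

End Stair.

(** Letters act from left to right: all of them together carry [p.-1] to the top, and each of the
    next [r] points is lowered once. *)
Lemma val_word_iota K p r (x : 'I_K.+1) : 0 < p -> p + r <= K.+1 ->
  word K (iota p r) x =
    (if x == p.-1 :> nat then p + r - 1 else if p <= x < p + r then x.-1 else x) :> nat.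
Proof.
elim: r p x => [|r IH] p x p0 pr.
  by rewrite /word big_nil perm1 addn0; do ![case: ifP => ?]; lia.
rewrite /= word_cons permM IH; try lia; rewrite val_adj; last by lia.
have xk := ltn_ord x; rewrite !addnS !addSn /=.
have [xp|xp] := eqVneq (x : nat) p.-1; first by do ![case: ifP => ?]; lia.
by have [xp'|xp'] := eqVneq (x : nat) p; do ![case: ifP => ?]; lia.
Qed.

Definition canonical K : seq nat := iota (K.+1 - K./2) K./2.

Lemma canonical_letters K : is_word K (canonical K).
Proof. by apply/allP=> j; rewrite mem_iota; lia. Qed.

Lemma canonical_cycleE K (x : 'I_K.+1) :
  (word K (canonical K) * w0 K.+1)%g x =
    (if x < K.+1./2 then K - x else if x == K.+1./2 :> nat then 0 else K.+1 - x) :> nat.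
Proof.
rewrite permM w0E /= val_word_iota; try lia.
have xk := ltn_ord x; do ![case: ifP => ?]; lia.
Qed.

Lemma canonical_oscillating K : oscillating_cycle (word K (canonical K) * w0 K.+1)%g.
Proof.
have E : (word K (canonical K) * w0 K.+1 * w0 K.+1)%g = word K (canonical K).
  by rewrite -mulgA w0K mulg1.
case: K E => [|K] E; first exact: oscillating_cycle1.
exists K.+2./2; split; [lia | |].
  by have [kodd|keven] := boolP (odd K); [apply: Or31; lia | apply: Or32; lia].
apply/imset_itv; [lia|]; rewrite E; apply/eqP; rewrite -leqn0.
apply: leq_trans (crossing_word _ (canonical_letters _)) _; first by lia.
by rewrite leqn0; apply/eqP/count_memPn; rewrite mem_iota; lia.
Qed.

Section StairLift.
Variables n K : nat.
Local Notation k := K.+1.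
Hypothesis kn : k <= n.
Variable phi : 'I_k -> 'I_n.
(** The first [k] entries of the stair list are the [k - k./2] smallest and the [k./2] largest
    values; [phi] lists them in increasing order. *)
Hypothesis phiE : forall i : 'I_k, phi i = (if i < k - k./2 then i : nat else i + (n - k)) :> nat.

Lemma stair_embeds : embeds phi (word K (canonical K) * w0 k)%g (stair_perm n (hook n k)).
Proof.
pose c := take k (stair_seq n); pose x0 := phi ord0.
have sc : size c = k by rewrite size_take size_stair_seq; case: ifP; lia.
have uc : uniq c by apply: take_uniq; exact: uniq_stair_seq.
have nth_c j : j < k -> nth x0 c j = stair n j :> nat.
  by move=> jk; rewrite nth_take // (nth_stair x0) //; lia.
have sE x : stair_perm n (hook n k) x = next c x.
  by rewrite stair_permE //; exact: cycle_permE.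
(* The 0-based position of [phi i] in the stair list: even for low values, odd for high ones. The
   canonical cycle advances it by one modulo [k]. *)
pose pos (i : 'I_k) := if i < k - k./2 then i.*2 else (K - i).*2.+1.
have pos_lt i : pos i < k by have ik := ltn_ord i; rewrite /pos; case: ifP; lia.
have phi_pos i : phi i = nth x0 c (pos i).
  apply: val_inj; rewrite /= nth_c // phiE /pos /stair; have ik := ltn_ord i.
  by do ![case: ifP => ?]; lia.
split=> [i j ij|i|x xC]; first by rewrite !phiE; have ik := ltn_ord j; do ![case: ifP => ?]; lia.
  rewrite sE phi_pos next_uniq_nth ?sc //.
  apply: val_inj; rewrite /= nth_c ?ltn_pmod // phiE canonical_cycleE /stair.
  have ik := ltn_ord i; have pi := pos_lt i.
  have [pk|pk] := ltnP (pos i).+1 k; last rewrite (_ : (pos i).+1 = k) ?modnn /=; try lia.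
    rewrite modn_small //; move: pk; rewrite /pos.
    by have [ilt|igt|ie] := ltngtP i k./2; have [ilt'|ige] := ltnP i (k - k./2) => pk;
      do ![case: ifP => ?]; lia.
  move: pk pi; rewrite /pos.
  by have [ilt|igt|ie] := ltngtP i k./2; have [ilt'|ige] := ltnP i (k - k./2) => pk pi';
    do ![case: ifP => ?]; lia.
rewrite sE next_nth ifN //.
apply: contra xC => /(nthP x0)[j jc <-]; rewrite sc in jc.
have [i iE] : exists i : 'I_k, i = (if odd j then K - j./2 else j./2) :> nat.
  have ik : (if odd j then K - j./2 else j./2) < k by case: ifP; lia.
  by exists (Ordinal ik).
apply/imsetP; exists i; rewrite // phi_pos; congr nth; rewrite /pos.
by move: iE; case: ifP => oj iE; case: ifP => ?; lia.
Qed.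

Lemma stair_outer : outer phi.
Proof.
move=> i im; split; apply/imsetP.
  have ik : i < k by lia.
  by exists (Ordinal ik) => //; apply: val_inj; rewrite /= phiE /=; case: ifP; lia.
have ik : K - i < k by lia.
exists (Ordinal ik) => //; apply: val_inj; rewrite /= phiE /=; case: ifP; lia.
Qed.

Lemma stair_length : max_length n K <= coxeter_length (stair_perm n (hook n k)).
Proof.
apply: leq_trans (oscillating_length stair_embeds stair_outer (canonical_oscillating K)).
rewrite leq_add2r; have := coxeter_length_w0 (word K (canonical K)).
have := coxeter_length_word (canonical_letters K); rewrite size_iota; lia.
Qed.

(** Once [center_move] has put the middle point at [k./2], [outer] determines the whole embedding,
    and the word determines the cycle. *)
Lemma codes_stair (psi : 'I_k -> 'I_n) sigma : codes (canonical K) psi sigma ->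
  cox_approx sigma (stair_perm n (hook n k)).
Proof.
move=> cw; have [psi' [sigma' [s' c' mid]]] : exists (psi' : 'I_k -> 'I_n) sigma',
    [/\ cox_approx sigma sigma', codes (canonical K) psi' sigma' &
    odd k -> psi' (inord k./2) = k./2 :> nat].
  have [kodd|keven] := boolP (odd k).
    have mn : k./2 < n by lia.
    have [|psi' [sigma' [s' c' E]]] := center_move (d := Ordinal mn) kodd cw.
      by rewrite [nat_of_ord _]/=; lia.
    by exists psi', sigma'; split=> //; rewrite E.
  by exists psi, sigma; split=> //; exact: cox_approx_refl.
case: c' => _ _ emb _ out; have psi_phi i : psi' i = phi i.
  apply: val_inj; rewrite /= phiE; case: ifP => ilt; last by rewrite (outer_hi emb out) //; lia.
  have [im|im] := ltnP i k./2; first by rewrite (outer_lo emb out).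
  have iE : i = inord k./2 by apply: val_inj; rewrite /= inordK; lia.
  have kodd : odd k by lia.
  by rewrite {1}iE mid //; lia.
suff <- : sigma' = stair_perm n (hook n k) by [].
apply/permP=> x; have [/imsetP[i _ ->]|xC] := boolP (x \in phi @: setT).
  by rewrite (embedsE stair_embeds) -!psi_phi (embedsE emb).
rewrite (embeds_fix stair_embeds xC) (embeds_fix emb) //.
by apply: contra xC => /imsetP[i _ ->]; rewrite psi_phi imset_f.
Qed.

End StairLift.

Theorem theorem4p65 (n k : nat) (sigma : 'S_n) :
  1 <= n -> 1 <= k <= n -> has_cycle_type sigma (hook n k) ->
  sigma \in Sigma_class n (hook n k) <-> hook_properties sigma k.
Proof.
case: k => [//|K] _ /= kn ct.
have [phi [tau [emb full]]] := embeds_exists ct.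
rewrite (hook_propertiesP emb full) // inE cox_approx_sym.
have [psi psiE] : exists psi : 'I_K.+1 -> 'I_n, forall i : 'I_K.+1,
    psi i = (if i < K.+1 - K.+1./2 then i : nat else i + (n - K.+1)) :> nat.
  have P (i : 'I_K.+1) : (if i < K.+1 - K.+1./2 then i : nat else i + (n - K.+1)) < n.
    by have ik := ltn_ord i; case: ifP; lia.
  by exists (fun i => Ordinal (P i)).
(* Length is constant on a class, and the stair form attains [max_length]. *)
split=> [/cox_approx_length len|[osc conn out]].
  by apply/(hook_max emb full); rewrite len (stair_length kn psiE).
(* Conversely, tightness gives a word of [K./2] letters; the moves to the canonical word lift to
   legal steps ending at the stair form. *)
have [w [lw wE sw]] := reduced_word (tau * w0 K.+1).
have wM : size w = K./2.
  apply/eqP; rewrite sw eqn_leq length_lower // andbT.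
  exact: tight_length full (tight_hook_cycle osc conn).
have pw := full_word full lw wE wM.
have tauE : (word K w * w0 K.+1)%g = tau by rewrite wE -mulgA w0K mulg1.
have cw : codes w phi sigma by split; rewrite ?tauE.
have wc : cyc_moves K w (canonical K).
  by apply: moves_canonical; rewrite ?subnn.
have [psi' [sigma' [s' c']]] := codes_moves wc cw.
exact: cox_approx_trans s' (codes_stair kn psiE c').
Qed.
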